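(* Let $X$ be a smooth projective toric variety over a field $\Bbbk$ with homogeneous coordinate ring $S$ graded by $G \cong \operatorname{Pic}(X)$, and let $\mathcal{C} = \{\mathbf{c}_1, \dotsc, \mathbf{c}_\ell\} \subset G$ be the minimal generating set of the semigroup of nef line bundles on $X$. Let $M$ be a finitely generated $G$-graded $S$-module. If $M$ is $\mathbf{m}$-regular (with respect to $\mathcal{C}$) for some $\mathbf{m} \in G$, then the degrees of the minimal generators of $M$ do not belong to the set $$\operatorname{reg}(M) + \Bigl( \bigcup_{1 \leq j \leq \ell} (\mathbf{c}_j + \mathbb{N}\mathcal{C}) \Bigr).$$
   Context: Homogeneous coordinate ring: let $X$ be given by a fan $\Delta$ in $\mathbb{R}^d$ whose rays have minimal lattice generators $\mathbf{b}_1, \dotsc, \mathbf{b}_n \in \mathbb{Z}^d$; identify each cone with the subset $\sigma \subseteq [n] = \{1,\dotsc,n\}$ of indices of its rays. Let $G$ be the cokernel of the map $\mathbb{Z}^d \to \mathbb{Z}^n$ given by the transpose of the matrix $[\mathbf{b}_1 \cdots \mathbf{b}_n]$ (the divisor class group, which equals $\operatorname{Pic}(X)$ as $X$ is smooth), and let $\mathbf{a}_i \in G$ be the image of the $i$-th standard basis vector. Then $S = \Bbbk[x_1, \dotsc, x_n]$ is graded by $G$ via $\deg(x_i) = \mathbf{a}_i$, and the irrelevant ideal is $B = \langle \prod_{i \notin \sigma} x_i : \sigma \in \Delta \rangle$. $\mathbb{N} = \{0,1,2,\dotsc\}$, and $\mathbb{N}\mathcal{C}$ is the subsemigroup (with $\mathbf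 0$) of $G$ generated by $\mathcal{C}$. $H_B^i(M)_{\mathbf{p}}$ is the degree $\mathbf{p}$ component of the $i$-th local cohomology module of $M$ with support in $B$. $M$ is $\mathbf{m}$-regular (with respect to $\mathcal{C}$) if: (1) $H_B^i(M)_{\mathbf{p}} = 0$ for all $i \geq 1$ and all $\mathbf{p} \in \bigcup (\mathbf{m} - \lambda_1 \mathbf{c}_1 - \dotsb - \lambda_\ell \mathbf{c}_\ell + \mathbb{N}\mathcal{C})$, the union being over all $\lambda_1, \dotsc, \lambda_\ell \in \mathbb{N}$ with $\lambda_1 + \dotsb + \lambda_\ell = i-1$; and (2) $H_B^0(M)_{\mathbf{p}} = 0$ for all $\mathbf{p} \in \bigcup_{1 \leq j \leq \ell} (\mathbf{m} + \mathbf{c}_j + \mathbb{N}\mathcal{C})$. Set $\operatorname{reg}(M) := \{\mathbf{p} \in G : M \text{ is } \mathbf{p}\text{-regular}\}$. ''Minimal generators'' means the elements of a minimal homogeneous generating set of $M$. *)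

(* Defs.v *)
From HB Require Import structures.
From mathcomp Require Import all_boot all_order all_algebra.
From mathcomp Require Import generic_quotient ring_quotient boolp mpoly.

Set Implicit Arguments.
Unset Strict Implicit.
Unset Printing Implicit Defensive.

Import Order.TTheory GRing.Theory Num.Theory.
Local Open Scope ring_scope.
Local Open Scope quotient_scope.

(* The rays of the fan are given by the matrix [b = [b_1 ... b_n]] of their
   minimal lattice generators; a cone is the set of indices of its rays. *)

Section Fan.
Variables (d n : nat) (b : 'M[int]_(d, n)) (Delta : {set {set 'I_n}}).

Definition pairing (u : 'cV[int]_d) (i : 'I_n) : int := (u^T *m b) 0 i.

(* Cones are tested on rational points: they are rational polyhedral, so all
   the conditions below hold over the reals iff they hold over the rationals. *)
Definition in_cone (sigma : {set 'I_n}) (v : 'cV[rat]_d) : Prop :=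
  exists2 a : 'I_n -> rat, (forall i, 0 <= a i)
    & v = \sum_(i in sigma) a i *: map_mx intr (col i b).

(* Smoothness is [fan_smooth]: the generators of each cone are part of a
   Z-basis of Z^d; in particular the cones are simplicial, and so the faces of
   [sigma] are its subsets. *)
Record is_smooth_fan : Prop := IsSmoothFan {
  fan_nonempty : set0 \in Delta;
  fan_rays : forall i, [set i] \in Delta;
  fan_faces : forall sigma tau : {set 'I_n},
    sigma \in Delta -> tau \subset sigma -> tau \in Delta;
  fan_inter : forall (sigma tau : {set 'I_n}) v,
    sigma \in Delta -> tau \in Delta ->
    in_cone sigma v -> in_cone tau v -> in_cone (sigma :&: tau) v;
  fan_smooth : forall sigma : {set 'I_n}, sigma \in Delta ->
    exists (U : 'M[int]_d) (f : 'I_n -> 'I_d),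
      [/\ U \in unitmx, {in sigma &, injective f}
        & {in sigma, forall i, col i b = col (f i) U}] }.

Definition complete_fan : Prop :=
  forall v, exists2 sigma : {set 'I_n}, sigma \in Delta & in_cone sigma v.

(* [D] is the divisor [\sum_i D_i D_(b_i)]; on each maximal cone [sigma] its
   support function is the linear form [u] with [<u, b_i> = - D_i] on the rays
   of [sigma], and strict convexity means that [<u, b_j> > - D_j] off [sigma]. *)
Definition strictly_convex (D : 'cV[int]_n) : Prop :=
  forall sigma : {set 'I_n}, sigma \in Delta -> #|sigma| = d ->
  exists u : 'cV[int]_d,
    (forall i, i \in sigma -> pairing u i = - D i 0) /\
    (forall j, j \notin sigma -> - D j 0 < pairing u j).

Definition smooth_projective_fan : Prop :=
  [/\ is_smooth_fan, complete_fan & exists D, strictly_convex D].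

(* [r] is the wall relation [b_i + b_j + \sum_(h in tau) r_h b_h = 0] of the
   (d-1)-dimensional cone [tau], which is the common facet of the d-dimensional
   cones [i |: tau] and [j |: tau].  It is unique, and [r_h] is the intersection
   number of the h-th torus-invariant divisor with the curve V(tau). *)
Definition wall_relation (tau : {set 'I_n}) (i j : 'I_n) (r : 'cV[int]_n) :=
  [/\ [/\ #|tau|.+1 = d, i \notin tau, j \notin tau & i != j],
      i |: tau \in Delta /\ j |: tau \in Delta,
      r i 0 = 1 /\ r j 0 = 1,
      forall h, h \notin i |: (j |: tau) -> r h 0 = 0
    & b *m r = 0].

(* D.C >= 0 for the torus-invariant curves C = V(tau), whose classes generate
   the cone of effective curve classes of X. *)
Definition nef_divisor (D : 'cV[int]_n) : Prop :=
  forall tau i j r, wall_relation tau i j r -> 0 <= \sum_h D h 0 * r h 0.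

Definition principal_div : {pred 'cV[int]_n} :=
  fun D => `[< exists u : 'cV[int]_d, D = b^T *m u >].

Fact principal_div_zmod_closed : zmod_closed principal_div.
Proof.
split=> [|x y]; first by apply/asboolP; exists 0; rewrite mulmx0.
move=> /asboolP[u ->] /asboolP[v ->]; apply/asboolP; exists (u - v).
by rewrite mulmxBr.
Qed.

HB.instance Definition _ :=
  GRing.isZmodClosed.Build 'cV[int]_n principal_div principal_div_zmod_closed.

(* The cokernel of [b^T : Z^d -> Z^n]. *)
Definition class_group : zmodType := Quotient.quot principal_div.

Definition div_class (D : 'cV[int]_n) : class_group := \pi_(Quotient.quot principal_div) D.

Definition nef (p : class_group) : Prop :=
  exists2 D, nef_divisor D & div_class D = p.

End Fan.

Section Semigroup.
Variables (G : zmodType) (l : nat) (c : 'I_l -> G).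

Definition nat_span (J : {set 'I_l}) (p : G) : Prop :=
  exists a : 'I_l -> nat, p = \sum_(j in J) c j *+ a j.

Definition minimal_semigroup_generators (P : G -> Prop) : Prop :=
  forall J : {set 'I_l}, (forall p, P p <-> nat_span J p) <-> J = [set: 'I_l].

End Semigroup.

Section GradedModules.
Variables (k : fieldType) (d n : nat) (b : 'M[int]_(d, n)).
Local Notation S := {mpoly k[n]}.
Local Notation G := (class_group b).

Definition mon_degree (m : 'X_{1..n}) : G :=
  div_class b (\col_i (m i)%:Z).

Definition homog_poly (a : G) (f : S) : Prop :=
  forall m, m \in msupp f -> mon_degree m = a.

(* The last two conditions say that M is the direct sum of the [piece p]. *)
Record is_grading (M : lmodType S) (piece : G -> M -> Prop) : Prop :=
  IsGrading {
    grading0 : forall p, piece p 0;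
    gradingB : forall p x y, piece p x -> piece p y -> piece p (x - y);
    gradingZ : forall a p f x,
      homog_poly a f -> piece p x -> piece (a + p) (f *: x);
    grading_sum : forall x, exists (s : seq G) (y : G -> M),
      (forall p, piece p (y p)) /\ x = \sum_(p <- s) y p;
    grading_direct : forall (s : seq G) (y : G -> M), uniq s ->
      (forall p, piece p (y p)) -> \sum_(p <- s) y p = 0 ->
      forall p, p \in s -> y p = 0 }.

Record gr_module := GrModule {
  gr_car :> lmodType S;
  piece : G -> gr_car -> Prop;
  gr_axiom : is_grading piece }.

Record gr_hom (M N : gr_module) := GrHom {
  gr_fun :> {linear M -> N};
  gr_homP : forall p x, piece p x -> piece p (gr_fun x) }.

Definition gr_injective (E : gr_module) : Prop :=
  forall (M N : gr_module) (f : gr_hom M N) (g : gr_hom M E),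
    injective f -> exists h : gr_hom N E, forall x, h (f x) = g x.

Record inj_resolution (M : gr_module) := InjResolution {
  res_mod :> nat -> gr_module;
  res_inj : forall i, gr_injective (res_mod i);
  res_aug : gr_hom M (res_mod 0%N);
  res_diff : forall i, gr_hom (res_mod i) (res_mod i.+1);
  res_aug_inj : injective res_aug;
  res_exact0 : forall x, res_diff 0%N x = 0 <-> exists y, res_aug y = x;
  res_exactS : forall i x,
    res_diff i.+1 x = 0 <-> exists y, res_diff i y = x }.

Definition lin_span (M : lmodType S) (E : M -> Prop) (x : M) : Prop :=
  exists s : seq (S * M), (forall e, e \in s -> E e.2) /\
    x = \sum_(e <- s) e.1 *: e.2.

Definition finitely_generated (M : gr_module) : Prop :=
  exists s : seq M, forall x, lin_span (fun y => y \in s) x.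

Definition minimal_homog_generators (M : gr_module) (E : M -> Prop) : Prop :=
  [/\ forall x, E x -> exists p, piece p x,
      forall x, lin_span E x
    & forall x, E x -> ~ forall y, lin_span (fun z => E z /\ z <> x) y].

Definition ideal_span (E : S -> Prop) (f : S) : Prop :=
  exists s : seq (S * S), (forall e, e \in s -> E e.2) /\
    f = \sum_(e <- s) e.1 * e.2.

Variable Delta : {set {set 'I_n}}.

Definition irrelevant_ideal : S -> Prop :=
  ideal_span (fun f => exists2 sigma : {set 'I_n}, sigma \in Delta
    & f = \prod_(i | i \notin sigma) 'X_i).

Definition irrelevant_power (e : nat) : S -> Prop :=
  ideal_span (fun f => exists2 t : 'I_e -> S,
    (forall i, irrelevant_ideal (t i)) & f = \prod_i t i).

Definition torsion (M : lmodType S) (x : M) : Prop :=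
  exists e, forall f, irrelevant_power e f -> f *: x = 0.

(* The degree p part of the i-th cohomology of Gamma_B(I) vanishes. *)
Definition torsion_cohomology_eq0 (M : gr_module) (I : inj_resolution M)
    (i : nat) (p : G) : Prop :=
  forall x : I i, torsion x -> piece p x -> res_diff I i x = 0 ->
  match i return I i -> Prop with
  | 0 => fun x => x = 0
  | i'.+1 => fun x =>
      exists y : I i', [/\ torsion y, piece p y & res_diff I i' y = x]
  end x.

(* H_B^i(M)_p = 0, where H_B^i is the i-th right derived functor of the
   B-torsion functor on graded modules; as these are independent of the
   injective resolution, the choice of [I] is irrelevant. *)
Definition local_cohomology_eq0 (M : gr_module) (i : nat) (p : G) : Prop :=
  exists I : inj_resolution M, torsion_cohomology_eq0 I i p.

Variables (l : nat) (c : 'I_l -> G).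
Local Notation NC := (nat_span c [set: 'I_l]).

Definition regular (M : gr_module) (m : G) : Prop :=
  (forall (i : nat) (lam : 'I_l -> nat) (q : G),
     (1 <= i)%N -> (\sum_j lam j)%N = (i - 1)%N -> NC q ->
     local_cohomology_eq0 M i (m - \sum_j c j *+ lam j + q)) /\
  (forall (j : 'I_l) (q : G), NC q ->
     local_cohomology_eq0 M 0 (m + c j + q)).

(* reg(M) + \bigcup_j (c_j + NC) *)
Definition reg_shift (M : gr_module) (p : G) : Prop :=
  exists (r : G) (j : 'I_l) (q : G),
    [/\ regular M r, NC q & p = r + (c j + q)].

End GradedModules.

(* Main.v *)
Require Import Defs.
From HB Require Import structures.
From mathcomp Require Import all_boot all_order all_algebra.
From mathcomp Require Import generic_quotient ring_quotient boolp mpoly zify ring lra.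

Set Implicit Arguments.
Unset Strict Implicit.
Unset Printing Implicit Defensive.

Import Order.TTheory GRing.Theory Num.Theory.
Local Open Scope ring_scope.
Local Open Scope quotient_scope.

(** A generator [x] of degree [p = r + c_j + q], with [r] in the regularity and [q]
    in the semigroup of the [c_i], lies in the submodule [S_(c_j) M]; so it is a
    combination of generators with nonconstant coefficients, and comparing degrees
    it is a combination of the other generators.

    Since [c_j] is nef, for each maximal cone there is a monomial of degree [c_j]
    in variables outside this cone ([nef_effective_off_cone]).  These monomials
    [f_1, ..., f_s] generate an ideal that contains a power of the irrelevant ideal
    [B].  Consider their Koszul complex on [M].  Its homology is [B]-torsion, and
    its term of homological degree [i] is a sum of copies of [M(- i c_j)].  The
    regularity of [r] says that [H_B^i(M)] vanishes in degree
    [p - i c_j = r - (i - 1) c_j + q] for all [i], and hence a diagram chase shows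
    that the homology [M / (f_1, ..., f_s) M] vanishes in degree [p]
    ([generated_by_monomials]).

    The chase takes place in the double complex of Koszul complexes of an
    injective resolution of [M].  It uses that the Koszul complex of a graded
    injective module is exact up to torsion elements
    ([kboundary_exact_mod_torsion]).  This rests on a special case of the Artin-Rees
    lemma, which can be seen on the exponents as the [f_h] are monomials
    ([free_ext_kcocycle]).  As the vanishing of each [H_B^i(M)_p] may be witnessed by
    its own resolution, resolutions are compared first
    ([torsion_cohomology_independent]).

    Nefness is given as nonnegativity on the invariant curves.  That it implies
    global generation ([nef_defect_ge0]) is shown by moving from the divisor
    towards an ample one until it becomes globally convex: at that moment some
    inequality is an equality, and this forces an equality at a wall
    ([degenerate_wall]), where the ample divisor is positive. *)

(** * Gradings and degrees of monomials *)

Section Grading.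
Variables (k : fieldType) (d n : nat) (b : 'M[int]_(d, n)).
Local Notation S := {mpoly k[n]}.
Local Notation G := (class_group b).
Local Notation gdeg := (@mon_degree d n b).

Lemma div_classD (D E : 'cV[int]_n) :
  div_class b (D + E) = div_class b D + div_class b E.
Proof. exact: raddfD. Qed.

Lemma div_class_eq0 (D : 'cV[int]_n) :
  div_class b D = 0 <-> exists u : 'cV[int]_d, D = b^T *m u.
Proof.
have -> : (0 : G) = div_class b 0.
  exact/esym/(raddf0 (\pi_(Quotient.quot (principal_div b)))).
split=> [/eqP|hD]; last apply/eqP.
  by rewrite /div_class -Quotient.idealrBE subr0 => /asboolP.
by rewrite /div_class -Quotient.idealrBE subr0; apply/asboolP.
Qed.

Lemma mon_degreeD (m1 m2 : 'X_{1..n}) : gdeg (m1 + m2)%MM = gdeg m1 + gdeg m2.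
Proof.
rewrite /mon_degree -div_classD; congr div_class.
by apply/matrixP=> i j; rewrite !mxE mnmDE PoszD.
Qed.

Lemma mon_degree0 : gdeg 0%MM = 0.
Proof. by apply: (addrI (gdeg 0%MM)); rewrite -mon_degreeD addm0 addr0. Qed.

Lemma homog_polyX (m : 'X_{1..n}) : homog_poly (k := k) (gdeg m) 'X_[m].
Proof. by move=> m' /mem_msuppXP <-. Qed.

Lemma homog_poly0 (a : G) : homog_poly (k := k) a 0.
Proof. by move=> m; rewrite msupp0. Qed.

Lemma homog_polyB (a : G) (f g : S) :
  homog_poly a f -> homog_poly a g -> homog_poly a (f - g).
Proof.
move=> hf hg m /msuppB_le; rewrite mem_cat => /orP[]; [exact: hf|exact: hg].
Qed.

Lemma homog_polyD (a : G) (f g : S) :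
  homog_poly a f -> homog_poly a g -> homog_poly a (f + g).
Proof.
move=> hf hg m /msuppD_le; rewrite mem_cat => /orP[]; [exact: hf|exact: hg].
Qed.

Lemma homog_polyM (a a' : G) (f g : S) :
  homog_poly a f -> homog_poly a' g -> homog_poly (a + a') (f * g).
Proof.
move=> hf hg m /msuppM_le /allpairsP[[m1 m2]] /= [h1 h2 ->].
by rewrite mon_degreeD (hf _ h1) (hg _ h2).
Qed.

Section Pieces.
Variable M : gr_module k b.

Lemma piece0 p : piece p (0 : M).
Proof. exact: grading0 (gr_axiom M) p. Qed.

Lemma pieceB p (x y : M) : piece p x -> piece p y -> piece p (x - y).
Proof. exact: gradingB (gr_axiom M) p x y. Qed.

Lemma pieceN p (x : M) : piece p x -> piece p (- x).
Proof. by move=> hx; rewrite -sub0r; apply: pieceB => //; exact: piece0. Qed.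

Lemma pieceD p (x y : M) : piece p x -> piece p y -> piece p (x + y).
Proof. by move=> hx hy; rewrite -[y]opprK; apply: pieceB => //; exact: pieceN. Qed.

Lemma piece_sum p (T : Type) (r : seq T) (P : pred T) (y : T -> M) :
  (forall t, P t -> piece p (y t)) -> piece p (\sum_(t <- r | P t) y t).
Proof. by move=> hy; elim/big_ind: _ => //; [exact: piece0 | exact: pieceD]. Qed.

Lemma pieceZ a p q (f : S) (x : M) :
  homog_poly a f -> piece p x -> a + p = q -> piece q (f *: x).
Proof. by move=> hf hx <-; exact: gradingZ (gr_axiom M) a p f x hf hx. Qed.

(** Since the pieces are independent, only the terms of degree [p] of a
    homogeneous decomposition contribute to an element of degree [p]. *)
Lemma piece_component (T : eqType) (r : seq T) (deg : T -> G) (y : T -> M) p x :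
  (forall t, t \in r -> piece (deg t) (y t)) -> piece p x -> x = \sum_(t <- r) y t ->
  x = \sum_(t <- r | deg t == p) y t.
Proof.
move=> hy hx ex.
pose Y q := \sum_(t <- r | deg t == q) y t - (if q == p then x else 0).
have hY q : piece q (Y q).
  apply: pieceB; last by case: eqP => [->|_] //; exact: piece0.
  by rewrite big_seq_cond; apply: piece_sum => t /andP[rt /eqP <-]; exact: hy.
pose s := undup (p :: map deg r).
have us : uniq s by exact: undup_uniq.
have sum_if q0 z : q0 \in s -> \sum_(q <- s) (if q == q0 then z else 0 : M) = z.
  move=> qs; rewrite (bigD1_seq q0) //= eqxx big1 ?addr0 // => q.
  by move=> /negPf ->.
have sum0 : \sum_(q <- s) Y q = 0.
  rewrite /Y big_split /= sumrN sum_if ?mem_undup ?inE ?eqxx //.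
  under eq_bigr => q _ do rewrite big_mkcond /=.
  rewrite exchange_big /= ex; apply/eqP; rewrite subr_eq0; apply/eqP.
  rewrite big_seq [RHS]big_seq; apply: eq_bigr => t rt.
  under eq_bigr => q _ do rewrite eq_sym.
  by rewrite sum_if // mem_undup inE map_f ?orbT.
have Yp : Y p = 0.
  by apply: (grading_direct (gr_axiom M) us hY sum0); rewrite mem_undup inE eqxx.
by apply/esym/subr0_eq; rewrite -[RHS]Yp /Y eqxx.
Qed.

Lemma homogeneous_parts (x : M) :
  exists (s : seq G) (y : G -> M), (forall p, piece p (y p)) /\ x = \sum_(p <- s) y p.
Proof. exact: grading_sum (gr_axiom M) x. Qed.
End Pieces.
End Grading.

(** * Morphisms into graded injective modules *)

Section Homomorphisms.
Variables (k : fieldType) (d n : nat) (b : 'M[int]_(d, n)).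
Local Notation S := {mpoly k[n]}.
Local Notation G := (class_group b).

Definition linear_pack (M N : lmodType S) (f : M -> N) (linf : linear f) :
  {linear M -> N} := HB.pack f (GRing.isLinear.Build S M N *:%R f linf).

Definition build_hom (M N : gr_module k b) (f : M -> N) (linf : linear f)
    (homf : forall p x, piece p x -> piece p (f x)) : gr_hom M N :=
  @GrHom k d n b M N (linear_pack linf) homf.

Lemma comp_hom_linear (M N P : gr_module k b) (g : gr_hom N P) (f : gr_hom M N) :
  linear (g \o f).
Proof. by move=> a x y; rewrite /= !linearP. Qed.

Definition comp_hom (M N P : gr_module k b) (g : gr_hom N P) (f : gr_hom M N) :
    gr_hom M P :=
  build_hom (comp_hom_linear g f)
    (fun p x hx => gr_homP g (gr_homP f hx)).

Lemma sub_hom_linear (M N : gr_module k b) (f g : gr_hom M N) :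
  linear (fun x => f x - g x).
Proof. by move=> a x y; rewrite !linearP scalerDr addrACA. Qed.

Definition sub_hom (M N : gr_module k b) (f g : gr_hom M N) : gr_hom M N :=
  build_hom (sub_hom_linear f g)
    (fun p x hx => pieceB (gr_homP f hx) (gr_homP g hx)).

Definition id_hom (M : gr_module k b) : gr_hom M M :=
  @build_hom M M id (fun _ _ _ => erefl) (fun _ _ hx => hx).

Lemma gr_homZ (M N : gr_module k b) (f : gr_hom M N) (a : S) (x : M) :
  f (a *: x) = a *: f x.
Proof. exact: linearZ. Qed.

Section Image.
Variables (U N : gr_module k b) (f : gr_hom U N).

Definition image_pred : {pred N} := fun x => `[< exists u, f u = x >].

Fact image_submod_closed : subsemimod_closed image_pred.
Proof.
split; first split.
- by apply/asboolP; exists 0; rewrite linear0.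
- move=> x y /asboolP[u <-] /asboolP[v <-]; apply/asboolP.
  by exists (u + v); rewrite linearD.
- move=> a x /asboolP[u <-]; apply/asboolP; exists (a *: u); by rewrite linearZ.
Qed.

HB.instance Definition _ :=
  GRing.isSubmodClosed.Build S N image_pred image_submod_closed.

Record image := Image { image_val : N; _ : image_val \in image_pred }.

HB.instance Definition _ := [isSub for image_val].
HB.instance Definition _ := [Choice of image by <:].
HB.instance Definition _ := [SubChoice_isSubLmodule of image by <:].

Lemma image_lift (x : image) : exists u, f u = val x.
Proof. by case: x => x hx; apply/asboolP. Qed.

Lemma image_mem u : f u \in image_pred.
Proof. by apply/asboolP; exists u. Qed.

Definition image_piece (p : G) (x : image) := piece p (val x).

Fact image_grading : is_grading image_piece.
Proof.
split.
- by move=> p; rewrite /image_piece raddf0; exact: piece0.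
- by move=> p x y hx hy; rewrite /image_piece raddfB; exact: pieceB.
- move=> a p g x hg hx; rewrite /image_piece linearZ; exact: pieceZ hg hx _.
- move=> x; have [u fu] := image_lift x.
  have [s [y [hy uy]]] := homogeneous_parts u.
  exists s, (fun p => Image (image_mem (y p))); split=> [p|].
    exact: gr_homP.
  by apply: val_inj; rewrite -fu uy !raddf_sum.
- move=> s y us hy sy p ps; apply: val_inj; rewrite raddf0.
  apply: (grading_direct (gr_axiom N) us (y := fun q => val (y q))) => //.
  by rewrite -raddf_sum sy raddf0.
Qed.

Definition image_module : gr_module k b := GrModule image_grading.

Fact image_val_linear : linear (val : image_module -> N).
Proof. by move=> a x y; rewrite linearP. Qed.

Definition image_inclusion : gr_hom image_module N :=
  @build_hom image_module N val image_val_linear (fun _ _ hx => hx).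

End Image.

(** Apply injectivity to the inclusion of the image of [f]: since [g] vanishes on
    the kernel of [f], it induces a morphism on this image.  All lifting below
    goes through this lemma, with [f] a differential or a Koszul differential. *)
Lemma injective_extension (U N E : gr_module k b) (f : gr_hom U N)
    (g : gr_hom U E) :
  gr_injective E -> (forall u, f u = 0 -> g u = 0) ->
  exists h : gr_hom N E, forall u, h (f u) = g u.
Proof.
move=> injE ker.
have gE u v : f u = f v -> g u = g v.
  move=> fuv; apply/eqP; rewrite -subr_eq0 -linearB; apply/eqP/ker.
  by rewrite linearB fuv subrr.
have [lift fl] := choice (@image_lift _ _ f).
have linh : linear (fun x : image_module f => g (lift x) : E).
  move=> a x y /=; rewrite -linearP; apply: gE.
  by rewrite linearP !fl linearP.
have homh p (x : image_module f) : piece p x -> piece p (g (lift x)).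
  move=> hx; have [s [y [hy luy]]] := homogeneous_parts (lift x).
  (* The lift of a homogeneous element need not be homogeneous, but its component
     of degree [p] is another lift. *)
  suff -> : g (lift x) = g (\sum_(q <- s | q == p) y q).
    by apply/gr_homP/piece_sum => q /eqP <-.
  apply: gE; rewrite fl raddf_sum.
  apply: (piece_component (deg := id) (y := fun q => f (y q))) => [q _||].
  - exact: gr_homP.
  - exact: hx.
  - by rewrite -fl luy raddf_sum.
have [|h hE] := injE _ _ (image_inclusion f) (build_hom linh homh).
  exact: val_inj.
exists h => u; have := hE (Image (image_mem f u)) => /= ->.
by apply: gE; rewrite fl.
Qed.

End Homomorphisms.

(** * Graded free modules *)

Section PolynomialTerms.
Variables (k : fieldType) (n : nat).
Local Notation S := {mpoly k[n]}.

(** The sum of the terms of [f] whose exponents satisfy [Q]. *)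
Definition mpart (Q : pred 'X_{1..n}) (f : S) : S :=
  \sum_(m <- msupp f | Q m) f@_m *: 'X_[m].

Lemma mcoeff_mpart Q f m : (mpart Q f)@_m = if Q m then f@_m else 0.
Proof.
rewrite /mpart raddf_sum /= -big_filter.
under eq_bigr => u _ do rewrite mcoeffZ mcoeffX.
case: (boolP (m \in [seq u <- msupp f | Q u])) => hm.
  rewrite (bigD1_seq m) ?filter_uniq ?msupp_uniq //= eqxx mulr1 big1.
    by move: hm; rewrite mem_filter => /andP[-> _]; rewrite addr0.
  by move=> u /negPf ->; rewrite mulr0.
rewrite big_seq big1 => [|u hu].
  move: hm; rewrite mem_filter; case: (Q m) => //= hm.
  by rewrite memN_msupp_eq0.
case: eqP => [eum|_]; last by rewrite mulr0.
by move: hm; rewrite -eum hu.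
Qed.

Lemma msupp_mpart Q f m : m \in msupp (mpart Q f) -> Q m /\ m \in msupp f.
Proof. by rewrite !mcoeff_msupp mcoeff_mpart; case: (Q m); rewrite ?eqxx. Qed.

Lemma mcoeffXM (m u : 'X_{1..n}) (f : S) :
  ('X_[m] * f)@_u = if (m <= u)%MM then f@_(u - m)%MM else 0.
Proof.
case: ifPn => hm; first by rewrite -{1}(submK hm) mulrC addmC mcoeffMX.
apply: memN_msupp_eq0; apply/negP => /msuppM_le /allpairsP[[m1 m2]] /= [].
rewrite msuppX inE => /eqP -> _ eu; move: hm; rewrite eu.
by rewrite lem_addr.
Qed.

Lemma mpartXM Q (m : 'X_{1..n}) (f : S) :
  mpart Q ('X_[m] * f) = 'X_[m] * mpart (fun u => Q (m + u)%MM) f.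
Proof.
apply/mpolyP => u; rewrite mcoeff_mpart !mcoeffXM mcoeff_mpart.
case: (boolP (m <= u)%MM) => hm; last by case: (Q u).
by rewrite /= [(m + _)%MM]addmC submK.
Qed.

Fact mpart_linear Q : linear (mpart Q).
Proof.
move=> a f g; apply/mpolyP => m; rewrite !(mcoeffD, mcoeffZ, mcoeff_mpart).
by case: (Q m); rewrite ?mulr0 ?addr0.
Qed.

HB.instance Definition _ Q := GRing.isLinear.Build k S S *:%R (mpart Q) (mpart_linear Q).

Lemma eq_mpart Q Q' (f : S) : Q =1 Q' -> mpart Q f = mpart Q' f.
Proof. by move=> eqQ; apply/mpolyP => m; rewrite !mcoeff_mpart eqQ. Qed.

Lemma divide_by_monomial (m : 'X_{1..n}) (f : S) :
  (forall u, u \in msupp f -> (m <= u)%MM) -> exists f', f = 'X_[m] * f'.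
Proof.
move=> hm; exists (\sum_(u <- msupp f) f@_u *: 'X_[u - m]%MM).
rewrite {1}[f]mpolyE mulr_sumr big_seq [RHS]big_seq; apply: eq_bigr => u hu.
by rewrite -scalerAr -mpolyXD addmC submK ?hm.
Qed.

End PolynomialTerms.

Section FreeModules.
Variables (k : fieldType) (d n : nat) (b : 'M[int]_(d, n)).
Local Notation S := {mpoly k[n]}.
Local Notation G := (class_group b).
Variables (T : finType) (dg : T -> G).

Definition free_piece (q : G) (v : {ffun T -> S^o}) :=
  forall t, homog_poly (q - dg t) (v t : S).

Fact free_grading : is_grading free_piece.
Proof.
split.
- by move=> p t; rewrite ffunE; exact: homog_poly0.
- by move=> p x y hx hy t; rewrite !ffunE; exact: homog_polyB.
- move=> a p f x hf hx t; rewrite ffunE -addrA; exact: homog_polyM.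
- move=> x.
  pose s := undup (flatten
    [seq [seq mon_degree b m + dg t | m <- msupp (x t : S)] | t <- enum T]).
  exists s, (fun q =>
    [ffun t => mpart (fun m => mon_degree b m == q - dg t) (x t) : S^o]).
  split=> [q t m|]; first by rewrite ffunE => /msupp_mpart[/eqP].
  apply/ffunP => t; rewrite sum_ffunE; apply/mpolyP => m; rewrite raddf_sum /=.
  under eq_bigr => q _ do rewrite ffunE mcoeff_mpart eq_sym subr_eq.
  case: (boolP (m \in msupp (x t : S))) => hm; last first.
    by rewrite memN_msupp_eq0 // big1 // => q _; case: ifP.
  rewrite (bigD1_seq (mon_degree b m + dg t)) ?undup_uniq //= ?eqxx ?big1 ?addr0 //.
    by move=> q /negPf ->.
  rewrite mem_undup; apply/flattenP.
  exists [seq mon_degree b m0 + dg t | m0 <- msupp (x t : S)]; last exact: map_f.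
  by apply/mapP; exists t; rewrite ?mem_enum.
- move=> s y us hy sy p ps; apply/ffunP => t; apply/mpolyP => m.
  rewrite ffunE mcoeff0; apply/eqP; apply: contraT => nz.
  have hm : mon_degree b m = p - dg t by apply: hy; rewrite mcoeff_msupp.
  have := congr1 (fun v : {ffun T -> S^o} => (v t : S)@_m) sy.
  rewrite sum_ffunE raddf_sum /= ffunE mcoeff0 (bigD1_seq p) //= big1 ?addr0.
    by move=> e; rewrite e eqxx in nz.
  move=> q qp; apply: memN_msupp_eq0; apply/negP => /hy; rewrite hm.
  by move/addIr => e; rewrite e eqxx in qp.
Qed.

Definition free_module : gr_module k b := GrModule free_grading.

Definition basis_vector (t : T) : free_module := [ffun u => (u == t)%:R : S^o].

Lemma basis_vectorE t u : basis_vector t u = (u == t)%:R :> S.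
Proof. by rewrite ffunE. Qed.

Lemma free_expansion (v : free_module) : v = \sum_t (v t : S) *: basis_vector t.
Proof.
apply/ffunP => u; rewrite sum_ffunE (bigD1 u) //= big1 ?addr0.
  by rewrite ffunE basis_vectorE eqxx [RHS]mulr1.
by move=> t; rewrite eq_sym ffunE basis_vectorE => /negPf ->; rewrite [LHS]mulr0.
Qed.

Lemma piece_basis_vector t : piece (dg t) (basis_vector t).
Proof.
move=> u m; rewrite basis_vectorE; case: eqP => [->|_]; last by rewrite msupp0.
by rewrite msupp1 inE subrr => /eqP ->; exact: mon_degree0.
Qed.

Section Extension.
Variables (N : gr_module k b) (e : T -> N).

Definition free_ext (v : free_module) : N := \sum_t (v t : S) *: e t.

Fact free_ext_linear : linear free_ext.
Proof.
move=> a x y; rewrite /free_ext scaler_sumr -big_split; apply: eq_bigr => t _ /=.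
by rewrite scalerA -scalerDl !ffunE.
Qed.

HB.instance Definition _ :=
  GRing.isLinear.Build S free_module N *:%R free_ext free_ext_linear.

Lemma free_ext_basis t : free_ext (basis_vector t) = e t.
Proof.
rewrite /free_ext (bigD1 t) //= big1 ?addr0 => [|u /negPf hu].
  by rewrite basis_vectorE eqxx scale1r.
by rewrite basis_vectorE hu scale0r.
Qed.

Hypothesis homog_e : forall t, piece (dg t) (e t).

Lemma free_ext_homog p (v : free_module) : piece p v -> piece p (free_ext v).
Proof.
move=> hv; apply: piece_sum => t _; apply: pieceZ (hv t) (homog_e t) _.
by rewrite subrK.
Qed.

Definition free_hom : gr_hom free_module N := build_hom free_ext_linear free_ext_homog.

End Extension.
End FreeModules.

(** * The Koszul complex *)

Section Koszul.
Variables (k : fieldType) (n s : nat) (f : 'I_s -> {mpoly k[n]}).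
Local Notation S := {mpoly k[n]}.
Implicit Types (A B : {set 'I_s}) (g h : 'I_s).

(** The sign of [e_h /\ e_A] when it is sorted into the basis of the exterior
    algebra. *)
Definition ksign h A : S := (-1) ^+ #|[set a in A | (a < h)%N]|.

Lemma ksignK h A : ksign h A * ksign h A = 1.
Proof. by rewrite -exprD addnn -mul2n exprM sqrrN !expr1n. Qed.

Lemma ksignU1 h g A : g \notin A ->
  ksign h (g |: A) = (if (g < h)%N then -1 else 1) * ksign h A.
Proof.
move=> gA; rewrite /ksign.
have -> : [set a in g |: A | (a < h)%N] =
    if (g < h)%N then g |: [set a in A | (a < h)%N] else [set a in A | (a < h)%N].
  apply/setP => a; case: ifP => gh; rewrite !inE; case: eqP => [->|_] //=.
  by rewrite gh andbF.
case: ifP => gh; last by rewrite mul1r.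
by rewrite cardsU1 !inE (negPf gA) /= exprS.
Qed.

Lemma ksign_swap h g A : h \notin A -> g \notin A -> g != h ->
  ksign h A * ksign g (h |: A) = - (ksign g A * ksign h (g |: A)).
Proof.
move=> hA gA gh; rewrite !ksignU1 //.
case: (ltngtP g h) => [lt|lt|/val_inj e]; last by rewrite e eqxx in gh.
  by ring.
by ring.
Qed.

(** The Koszul complex [K(f; M)], with all homological degrees in one function:
    its part of degree [i] consists of the values at the subsets [A] of cardinal
    [i]. *)
Definition kboundary (M : lmodType S) (y : {set 'I_s} -> M) A : M :=
  \sum_(h | h \notin A) (ksign h A * f h) *: y (h |: A).

Lemma kboundaryD (M : lmodType S) (y z : {set 'I_s} -> M) A :
  kboundary (fun B => y B + z B) A = kboundary y A + kboundary z A.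
Proof. by rewrite -big_split; apply: eq_bigr => h _; rewrite scalerDr. Qed.

Lemma kboundary_linear (M N : lmodType S) (F : {linear M -> N})
    (y : {set 'I_s} -> M) A :
  F (kboundary y A) = kboundary (fun B => F (y B)) A.
Proof. by rewrite linear_sum; apply: eq_bigr => h _; rewrite linearZ. Qed.

(** The terms of the double sum cancel in pairs, by [ksign_swap]; they are split
    according to the order of [g] and [h] because a sum that equals its opposite
    need not vanish in characteristic two. *)
Lemma kboundaryK (M : lmodType S) (y : {set 'I_s} -> M) A :
  kboundary (kboundary y) A = 0.
Proof.
pose X h g := (ksign h A * f h * (ksign g (h |: A) * f g)) *: y (g |: (h |: A)).
have Xanti h g : h \notin A -> g \notin A -> g != h -> X h g = - X g h.
  move=> hA gA gh; rewrite /X setUCA -scaleNr; congr (_ *: _).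
  rewrite mulrACA ksign_swap // [in RHS]mulrACA; ring.
transitivity (\sum_(h | h \notin A) \sum_(g | (g \notin A) && (g != h)) X h g).
  apply: eq_bigr => h hA; rewrite /kboundary scaler_sumr.
  apply: eq_big => [g|g _]; last by rewrite scalerA.
  by rewrite !inE negb_or andbC.
transitivity (\sum_(h | h \notin A) \sum_(g | (g \notin A) && (g < h)%N) X h g
            + \sum_(h | h \notin A) \sum_(g | (g \notin A) && (h < g)%N) X h g).
  rewrite -big_split; apply: eq_bigr => h hA /=.
  rewrite (bigID (fun g : 'I_s => (g < h)%N)) /=; congr (_ + _); apply: eq_bigl => g.
    rewrite -val_eqE /=; case: (g \in A) => //=; lia.
  rewrite -val_eqE /=; case: (g \in A) => //=; lia.
rewrite [X in _ + X](exchange_big_dep (fun g => g \notin A)) /=; last first.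
  by move=> h g _ /andP[].
rewrite -big_split big1 // => h hA /=.
rewrite [X in _ + X](eq_bigl (fun g => (g \notin A) && (g < h)%N)) => [|g]; last first.
  by rewrite hA.
rewrite -big_split big1 // => g /andP[gA gh] /=.
by rewrite (Xanti g h) ?subrr // -val_eqE /= neq_ltn gh orbT.
Qed.

(** The dual complex of free modules: elements of [K(f; M)] are the morphisms from
    it to [M], and [kboundary] is the precomposition with [kcoboundary]; this is
    [kboundary_adjoint]. *)
Definition kcoboundary (v : {ffun {set 'I_s} -> S^o}) : {ffun {set 'I_s} -> S^o} :=
  [ffun A : {set 'I_s} => \sum_(h in A) ksign h (A :\ h) * f h * v (A :\ h)].

Fact kcoboundary_linear : linear kcoboundary.
Proof.
move=> a x y; apply/ffunP => A; rewrite !ffunE scaler_sumr -big_split /=.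
apply: eq_bigr => h _; rewrite !ffunE mulrDr; congr (_ + _).
rewrite /GRing.scale /=; ring.
Qed.

HB.instance Definition _ := GRing.isLinear.Build S {ffun {set 'I_s} -> S^o}
  {ffun {set 'I_s} -> S^o} *:%R kcoboundary kcoboundary_linear.

Lemma kboundary_adjoint (M : lmodType S) (y : {set 'I_s} -> M)
    (v : {ffun {set 'I_s} -> S^o}) :
  \sum_A (kcoboundary v A : S) *: y A = \sum_A (v A : S) *: kboundary y A.
Proof.
under eq_bigr => A _ do rewrite ffunE scaler_suml.
under [RHS]eq_bigr => A _ do rewrite scaler_sumr.
rewrite (exchange_big_dep predT) //= [RHS](exchange_big_dep predT) //=.
apply: eq_bigr => h _.
rewrite (reindex_onto (fun A => h |: A) (fun A => A :\ h)) /=; last first.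
  by move=> A; apply: setD1K.
apply: eq_big => [A|A /andP[_ /eqP e]].
  rewrite setU11 /=; apply/eqP/idP => [<-|hA]; first by rewrite !inE eqxx.
  by rewrite setU1K.
by rewrite e scalerA mulrC.
Qed.

Definition kcontract g (v : {ffun {set 'I_s} -> S^o}) : {ffun {set 'I_s} -> S^o} :=
  [ffun A : {set 'I_s} => if g \in A then 0 else ksign g A * v (g |: A)].

(** Contraction with [g] is a homotopy from multiplication by [f g] to zero, so
    [f g] maps cocycles to coboundaries. *)
Lemma kcontract_homotopy g (v : {ffun {set 'I_s} -> S^o}) :
  kcoboundary v = 0 -> kcoboundary (kcontract g v) = f g *: v.
Proof.
move=> dv; apply/ffunP => A; rewrite !ffunE /=.
have [gA|gA] := boolP (g \in A).
  rewrite (bigD1 g) //= big1 ?addr0 => [|h /andP[hA hg]].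
    rewrite ffunE !inE eqxx /= setD1K //.
    by rewrite mulrACA ksignK mul1r.
  by rewrite ffunE !inE eq_sym hg gA mulr0.
have := congr1 (fun w : {ffun {set 'I_s} -> S^o} => (ksign g A : S) * (w (g |: A) : S)) dv.
rewrite !ffunE mulr0 (bigD1 g) ?setU11 //= setU1K // mulrDr !mulrA ksignK mul1r.
move=> /eqP; rewrite addr_eq0 => /eqP e; rewrite [RHS]e mulr_sumr -sumrN {e}.
apply: eq_big => [h|h hA].
  by rewrite !inE; case: eqP => [->|_]; rewrite ?(negPf gA) ?andbF //= andbT.
have hg : h != g by apply: contraNneq gA => <-.
rewrite ffunE !inE (negPf gA) andbF.
have -> : (g |: A) :\ h = g |: (A :\ h).
  by apply/setP => a; rewrite !inE; case: (a =P g) => // ->; rewrite eq_sym hg.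
have gA' : g \notin A :\ h by rewrite !inE (negPf gA) andbF.
have hA' : h \notin A :\ h by rewrite !inE eqxx.
have eg := ksignU1 g hA'; rewrite setD1K // in eg.
rewrite eg (ksignU1 h gA').
case: (ltngtP g h) => [lt|lt|/val_inj e]; last by rewrite e eqxx in hg.
  by ring.
by ring.
Qed.

End Koszul.

(** * Koszul complexes of injective modules are exact up to torsion *)

Lemma mulmnDr n (m : 'X_{1..n}) i j : (m *+ (i + j) = m *+ i + m *+ j)%MM.
Proof. by apply/mnmP => x; rewrite mnmDE !mulmnE mulnDr. Qed.

Section KoszulMonomials.
Variables (k : fieldType) (n s : nat) (mu gam : 'I_s -> 'X_{1..n}).
Local Notation S := {mpoly k[n]}.
Local Notation F := {ffun {set 'I_s} -> S^o}.
Local Notation f := (fun h => 'X_[mu h] : S).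
Implicit Types (A B : {set 'I_s}) (g h : 'I_s).

(** The coordinates [u i + \sum_(g | g \notin A) mu g i] form the multidegree of
    the term ['X_[u]] at position [A], shifted by a constant to avoid negative values;
    [kcoboundary] preserves it.  The class of a term is some [h] such that this
    multidegree is large on the support of [gam h]. *)
Definition term_class (N : nat) A (u : 'X_{1..n}) : option 'I_s :=
  [pick h | [forall i, (0 < gam h i)%N ==>
     (N <= u i + \sum_(g | g \notin A) mu g i)%N]].

Lemma term_class_shift N A h u : h \in A ->
  term_class N A (mu h + u)%MM = term_class N (A :\ h) u.
Proof.
move=> hA; apply: eq_pick => g; apply: eq_forallb => i.
rewrite mnmDE [in RHS](bigD1 h) /= ?inE ?eqxx //.
rewrite [in RHS](eq_bigl (fun j => j \notin A)) => [|j]; first by rewrite addnCA addnA.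
by rewrite !inE; case: eqP => [->|_]; rewrite ?hA ?andbF ?andbT.
Qed.

Definition class_part N h (v : F) : F :=
  [ffun A : {set 'I_s} => mpart (fun u => term_class N A u == Some h) (v A : S) : S^o].

(** The class depends only on the multidegree, which [kcoboundary] preserves. *)
Lemma kcoboundary_class_part N h (v : F) :
  kcoboundary f (class_part N h v) = class_part N h (kcoboundary f v).
Proof.
apply/ffunP => A; rewrite !ffunE raddf_sum /=; apply: eq_bigr => g gA.
rewrite ffunE.
have sgn (x : S) (e : bool) : mpart (fun u => term_class N A u == Some h) ((-1) ^+ e * x) =
    (-1) ^+ e * mpart (fun u => term_class N A u == Some h) x.
  by case: e; rewrite ?expr1 ?expr0 ?mulN1r ?mul1r ?raddfN.
rewrite /ksign -signr_odd -!mulrA sgn; congr (_ * _).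
rewrite mpartXM; congr (_ * _); apply: eq_mpart => u.
by rewrite term_class_shift.
Qed.

Lemma class_part_sum N (v : F) :
  (forall A u, u \in msupp (v A : S) -> term_class N A u != None) ->
  v = \sum_h class_part N h v.
Proof.
move=> hv; apply/ffunP => A; rewrite sum_ffunE; apply/mpolyP => u.
rewrite raddf_sum /=; under eq_bigr => h _ do rewrite ffunE mcoeff_mpart.
case: (boolP (u \in msupp (v A : S))) => hu; last first.
  by rewrite memN_msupp_eq0 // big1 // => h _; case: ifP.
case e: (term_class N A u) (hv _ _ hu) => [h|] // _.
rewrite (bigD1 h) //= eqxx big1 ?addr0 // => g gh; case: eqP => // -[e'].
by rewrite e' eqxx in gh.
Qed.

Hypothesis gam_le1 : forall h i, (gam h i <= 1)%N.

Let mu_bound := (\sum_g \sum_i mu g i)%N.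

(** The exponent of a term differs from its multidegree by at most [mu_bound]. *)
Lemma class_part_divisible e N h (v : F) : (e + mu_bound <= N)%N ->
  exists v' : F, class_part N h v = 'X_[gam h *+ e] *: v'.
Proof.
move=> eN.
have /choice[w hw] : forall A, exists q : S,
    (class_part N h v A : S) = 'X_[gam h *+ e] * q.
  move=> A; apply: divide_by_monomial => u; rewrite ffunE.
  move=> /msupp_mpart[/eqP]; rewrite /term_class; case: pickP => // g hg [eg] _.
  rewrite {}eg in hg; apply/mnm_lepP => i; rewrite mulmnE.
  have := gam_le1 h i; have /forallP/(_ i)/implyP := hg.
  have : (\sum_(g | g \notin A) mu g i <= mu_bound)%N.
    rewrite big_mkcond /=; apply: leq_sum => j _; case: ifP => // _.
    by rewrite (bigD1 i) //= leq_addr.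
  case: (gam h i) => [|[|]] //= b1 /(_ isT) b2 _.
  by lia.
exists [ffun A => w A : S^o]; apply/ffunP => A.
by rewrite [RHS]ffunE [X in _ = _ *: X]ffunE [LHS]hw.
Qed.

Lemma kcoboundary_torsion_free (m : 'X_{1..n}) (v : F) :
  kcoboundary f ('X_[m] *: v) = 0 -> kcoboundary f v = 0.
Proof.
rewrite linearZ => e; apply/ffunP => A; rewrite [RHS]ffunE.
have := congr1 (fun w : F => (w A : S)) e; rewrite [in RHS]ffunE ffunE.
move/eqP; rewrite mulf_eq0 => /orP[/eqP e0|/eqP //].
by have := mcoeffX k m m; rewrite e0 mcoeff0 eqxx => /esym/eqP; rewrite oner_eq0.
Qed.

End KoszulMonomials.

Section KoszulExactness.
Variables (k : fieldType) (d n s : nat) (b : 'M[int]_(d, n)).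
Local Notation S := {mpoly k[n]}.
Local Notation G := (class_group b).
Variables (mu gam : 'I_s -> 'X_{1..n}) (c p : G) (k1 : nat).
Hypothesis mu_deg : forall h, mon_degree b (mu h) = c.
Hypothesis gam_le1 : forall h i, (gam h i <= 1)%N.
Hypothesis mu_le : forall h, (mu h <= gam h *+ k1)%MM.
Local Notation f := (fun h => 'X_[mu h] : S).
Local Notation dg := (fun A : {set 'I_s} => p - c *+ #|A|).
Implicit Types (A B : {set 'I_s}) (g h : 'I_s).

(** When the monomials ['X_[gam h]] generate the irrelevant ideal up to radical,
    these are the torsion elements: see [torsion_mon_torsion]. *)
Definition mon_torsion (M : lmodType S) (x : M) :=
  exists e, forall h, 'X_[gam h *+ e] *: x = 0.

(* The basis vector of [A] has the degree of the values at [A] of a homogeneous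
   element of degree [p] of the Koszul complex. *)
Let F := @free_module k d n b {set 'I_s} dg.

Lemma homog_ksign h A : homog_poly (k := k) (0 : G) (ksign k n h A).
Proof.
rewrite /ksign -signr_odd; case: (odd _) => m.
  by rewrite expr1 (perm_mem (msuppN _)) msupp1 inE => /eqP ->; exact: mon_degree0.
by rewrite expr0 msupp1 inE => /eqP ->; exact: mon_degree0.
Qed.

Lemma kboundary_homog (M : gr_module k b) (y : {set 'I_s} -> M) :
  (forall A, piece (dg A) (y A)) -> forall A, piece (dg A) (kboundary f y A).
Proof.
move=> hy A; apply: piece_sum => h hA; apply: pieceZ (hy _) _.
  exact: homog_polyM (@homog_ksign h A) (@homog_polyX k d n b (mu h)).
by rewrite /= cardsU1 hA add0r mu_deg mulrS opprD [p + _]addrCA addNKr.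
Qed.

Lemma kcoboundary_homog q (v : F) : piece q v -> piece (g := F) q (kcoboundary f v).
Proof.
move=> hv A; rewrite /kcoboundary ffunE.
have hs : forall h, h \in A ->
    homog_poly (q - dg A) (ksign k n h (A :\ h) * 'X_[mu h] * (v (A :\ h) : S)).
  move=> h hA m hm.
  have hX := homog_polyM (@homog_ksign h (A :\ h)) (@homog_polyX k d n b (mu h)).
  rewrite (homog_polyM hX (hv (A :\ h)) hm).
  rewrite mu_deg add0r (cardsD1 h A) hA mulrS !opprD !opprK; rewrite addrCA.
  by congr (_ + _); rewrite addrCA.
elim/big_ind: _ => // [|x y hx hy]; first exact: homog_poly0.
exact: homog_polyD hx hy.
Qed.

Definition kcoboundary_hom : gr_hom F F :=
  @build_hom k d n b F F (kcoboundary f) (kcoboundary_linear f) kcoboundary_homog.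

Lemma mon_torsion_uniform (M : lmodType S) (T : finType) (z : T -> M) :
  (forall t, mon_torsion (z t)) ->
  exists e, forall h t, 'X_[gam h *+ e] *: z t = 0.
Proof.
move=> /choice[e he]; exists (\sum_t e t)%N => h t.
by rewrite (bigD1 t) //= mulmnDr mpolyXD mulrC -scalerA he scaler0.
Qed.

(** This takes the place of the Artin-Rees lemma: a cocycle [v] whose coefficients
    lie in high powers of the monomials ['X_[gam h]] is a sum of cocycles
    ['X_[gam h *+ (e + k1)] *: v'], namely its class parts.  The factor
    ['X_[gam h *+ k1]] is a multiple of ['X_[mu h]] and turns [v'] into a
    coboundary, on which [free_ext y] takes values in the span of the values of
    [kboundary y]; the factor ['X_[gam h *+ e]] annihilates these. *)
Lemma free_ext_kcocycle (M : gr_module k b) (y : {set 'I_s} -> M) :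
  (forall A, mon_torsion (kboundary f y A)) ->
  exists N, forall v : F, kcoboundary f v = 0 ->
    (forall A u, u \in msupp (v A : S) -> exists h, (gam h *+ N <= u)%MM) ->
    free_ext y v = 0.
Proof.
move=> /mon_torsion_uniform[e he].
pose N := (e + k1 + \sum_g \sum_i mu g i)%N; exists N => v dv hv.
rewrite (@class_part_sum k n s mu gam N v); last first.
  move=> A u /hv[h hu]; rewrite /term_class; case: pickP => // /(_ h)/negP[].
  apply/forallP => i; apply/implyP => gi; apply: leq_trans (leq_addr _ _).
  apply: leq_trans (mnm_lepP hu i); rewrite mulmnE.
  by rewrite -{1}[N]mul1n leq_mul2r gi orbT.
have extZ a (w : F) : free_ext y (a *: w) = a *: free_ext y w by exact: linearZ.
rewrite [LHS](raddf_sum (free_ext (N := M) y)); apply: big1 => h _.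
have [v' ev] := @class_part_divisible k n s mu gam gam_le1 (e + k1) N h v (leqnn _).
have dv' : kcoboundary f v' = 0.
  apply: (@kcoboundary_torsion_free k n s mu (gam h *+ (e + k1))).
  by rewrite -ev kcoboundary_class_part dv; apply/ffunP => A; rewrite !ffunE raddf0.
rewrite ev [LHS]extZ.
have -> : (gam h *+ (e + k1) = gam h *+ e + ((gam h *+ k1 - mu h) + mu h))%MM.
  by rewrite submK ?mulmnDr.
rewrite !mpolyXD mulrCA -!scalerA -[X in _ *: (_ *: X)]extZ.
have /= <- := @kcontract_homotopy k n s f h v' dv'; rewrite /free_ext kboundary_adjoint.
rewrite scaler_sumr big1 ?scaler0 // => A _.
by rewrite scalerA mulrC -scalerA he scaler0.
Qed.

(** The Koszul complex of a graded injective module is exact modulo torsion: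
    for a cycle [y] up to torsion, the corresponding morphism [phi] from the dual
    complex vanishes, by [free_ext_kcocycle], on those cocycles that are
    combinations of the ['X_[gam h *+ N]].  So on the submodule spanned by these
    multiples, [phi] factors through the differential, and the factor extends to
    [theta] as [E] is injective.  The difference of [phi] and of the coboundary of
    [theta] is annihilated by all ['X_[gam h *+ N]]. *)
Lemma kboundary_exact_mod_torsion (E : gr_module k b) (y : {set 'I_s} -> E) :
  gr_injective E -> (forall A, piece (dg A) (y A)) ->
  (forall A, mon_torsion (kboundary f y A)) ->
  exists t z : {set 'I_s} -> E,
    [/\ forall A, piece (dg A) (t A), forall A, piece (dg A) (z A),
        forall A, mon_torsion (t A) & forall A, y A = t A + kboundary f z A].
Proof.
move=> injE hy /free_ext_kcocycle[N hN].
(* [emb] maps the free module on the pairs [(h, A)] onto the submodule of the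
   combinations of the ['X_[gam h *+ N]]. *)
pose dgU (x : 'I_s * {set 'I_s}) : G := mon_degree b (gam x.1 *+ N) + dg x.2.
pose eU (x : 'I_s * {set 'I_s}) : F := ('X_[gam x.1 *+ N] : S) *: basis_vector k dg x.2.
have homU x : piece (dgU x) (eU x).
  exact: (@pieceZ k d n b F _ _ _ _ _ (@homog_polyX k d n b (gam x.1 *+ N))
    (@piece_basis_vector k d n b _ dg x.2) erefl).
pose emb := free_hom homU; pose phi := free_hom hy.
have [|theta htheta] := injective_extension (f := comp_hom kcoboundary_hom emb)
    (g := comp_hom phi emb) injE.
  move=> u du; apply: hN => // A m; rewrite /= /free_ext sum_ffunE.
  move=> /msupp_sum_le /flattenP[r /mapP[x _ ->]]; rewrite !ffunE.
  move=> /msuppM_le /allpairsP[[m1 m2]] /= [_ hm2 ->].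
  move: hm2 => /msuppM_le /allpairsP[[m3 m4]] /= [h3 _ ->]; exists x.1.
  move: h3; rewrite msuppX inE => /eqP ->; apply/mnm_lepP => i.
  by rewrite !mnmDE addnCA leq_addr.
have embE h A : emb (basis_vector k dgU (h, A)) = ('X_[gam h *+ N] : S) *: basis_vector k dg A.
  exact: free_ext_basis.
have thetaE A : theta (kcoboundary_hom (basis_vector k dg A)) =
    kboundary f (fun B => theta (basis_vector k dg B)) A.
  rewrite [X in theta X]free_expansion linear_sum.
  under eq_bigr => B _ do rewrite linearZ.
  by rewrite /= kboundary_adjoint -/(free_ext (N := E) _ _) free_ext_basis.
exists (fun A => y A - kboundary f (fun B => theta (basis_vector k dg B)) A).
exists (fun A => theta (basis_vector k dg A)).
have hz A : piece (dg A) (theta (basis_vector k dg A)).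
  exact/gr_homP/(@piece_basis_vector k d n b _ dg A).
split=> // A; last by rewrite subrK.
- by apply: pieceB => //; exact: kboundary_homog.
- have yE : y A = phi (basis_vector k dg A) by exact/esym/free_ext_basis.
  exists N => h; rewrite scalerBr -thetaE yE -!gr_homZ -embE.
  by apply/eqP; rewrite subr_eq0; apply/eqP/esym/htheta.
Qed.

End KoszulExactness.

(** * Torsion and independence of the resolution *)

Section Torsion.
Variables (k : fieldType) (n s : nat) (Delta : {set {set 'I_n}}).
Local Notation S := {mpoly k[n]}.
Variable sigma : 'I_s -> {set 'I_n}.
Hypothesis sigma_cone : forall h, sigma h \in Delta.
Hypothesis sigma_cofinal : forall tau, tau \in Delta -> exists h, tau \subset sigma h.

Definition off_cone (tau : {set 'I_n}) : 'X_{1..n} := [multinom (i \notin tau : nat) | i < n].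
Local Notation gam := (fun h => off_cone (sigma h)).

Lemma off_coneE (tau : {set 'I_n}) :
  'X_[off_cone tau] = \prod_(i | i \notin tau) 'X_i :> S.
Proof.
rewrite mpolyXE_id [RHS]big_mkcond; apply: eq_bigr => i _; rewrite mnmE.
by case: (i \notin tau); rewrite ?expr1 ?expr0.
Qed.

(** The generator of a cone is a multiple of that of a larger cone, so the
    cofinal family [sigma] suffices. *)
Lemma irrelevant_ideal_maximal (f : S) : irrelevant_ideal Delta f ->
  exists a : 'I_s -> S, f = \sum_h a h * 'X_[gam h].
Proof.
move=> [r [hr ->]]; elim: r hr => [|e r IHr] hr.
  by exists (fun=> 0); rewrite big_nil big1 // => h _; rewrite mul0r.
have [|a ea] := IHr; first by move=> e' he'; apply: hr; rewrite inE he' orbT.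
have [tau hD e2] := hr e (mem_head _ _); have [h hh] := sigma_cofinal hD.
exists (fun g => a g + if g == h then e.1 * 'X_[off_cone tau - off_cone (sigma h)]%MM else 0).
under [RHS]eq_bigr => g _ do rewrite mulrDl.
rewrite big_cons big_split /= -ea addrC; congr (_ + _).
rewrite (bigD1 h) //= eqxx big1 ?addr0 => [|g /negPf ->]; last by rewrite mul0r.
rewrite -mulrA -mpolyXD submK ?off_coneE ?e2 //.
apply/mnm_lepP => i; rewrite !mnmE.
by have /subsetP/(_ i) := hh; case: (i \in tau) => [->|] //; case: (i \in sigma h).
Qed.

(** A product of [s * e + 1] elements of the irrelevant ideal expands into
    products of as many of the [s] generators, and by the pigeonhole principle one
    of them is repeated [e] times in each of these. *)
Lemma torsion_mon_torsion (M : lmodType S) (x : M) :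
  torsion Delta x <-> mon_torsion gam x.
Proof.
split=> [[e he]|[e he]].
  exists e => h; apply: he; exists [:: (1, 'X_[gam h *+ e])]; split; last first.
    by rewrite big_seq1 mul1r.
  move=> _ /[1!inE] /eqP -> /=; exists (fun=> 'X_[gam h]) => [_|].
    exists [:: (1, 'X_[gam h])]; split; last by rewrite big_seq1 mul1r.
    move=> _ /[1!inE] /eqP -> /=; exists (sigma h); first exact: sigma_cone.
    by rewrite off_coneE.
  by rewrite prodr_const card_ord mpolyXn.
exists (s * e).+1 => f [r [hr ->]]; rewrite scaler_suml big_seq big1 // => q /hr.
move=> [t ht e2]; rewrite -scalerA {}e2.
suff -> : \prod_i t i *: x = 0 by rewrite scaler0.
have /choice[a ha] i := irrelevant_ideal_maximal (ht i).
under eq_bigr => i _ do rewrite ha.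
rewrite bigA_distr_bigA scaler_suml big1 // => phi _ /=.
rewrite big_split -scalerA /=.
suff -> : \prod_i 'X_[gam (phi i)] *: x = 0 by rewrite scaler0.
have [h hh] : exists h, (e <= #|[set i | phi i == h]|)%N.
  apply/existsP; apply: contraT => /existsPn small.
  suff : ((s * e).+1 <= s * e)%N by rewrite ltnn.
  rewrite -{1}[(s * e).+1]card_ord -sum1_card.
  rewrite (partition_big phi predT) //=.
  apply: (@leq_trans (\sum_(h < s) e)%N); last by rewrite sum_nat_const card_ord.
  apply: leq_sum => h _; have := small h; rewrite -ltnNge => /ltnW.
  by rewrite -sum1_card; under eq_bigl => i do rewrite inE.
rewrite (bigID (fun i => phi i == h)) /= mulrC -scalerA.
suff -> : \prod_(i | phi i == h) 'X_[gam (phi i)] *: x = 0 by rewrite scaler0.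
rewrite (eq_bigr (fun=> 'X_[gam h])) => [|i /eqP -> //].
rewrite (eq_bigl (fun i => i \in [set i | phi i == h])) => [|i]; last by rewrite inE.
by rewrite prodr_const -(subnK hh) exprD -scalerA [in X in _ *: X]mpolyXn he scaler0.
Qed.

End Torsion.

Section MonomialTorsion.
Variables (k : fieldType) (n s : nat) (gam : 'I_s -> 'X_{1..n}).
Local Notation S := {mpoly k[n]}.
Variable M : lmodType S.
Implicit Types x y : M.

Lemma mon_torsion0 : mon_torsion gam (0 : M).
Proof. by exists 0%N => h; rewrite scaler0. Qed.

Lemma mon_torsionD x y : mon_torsion gam x -> mon_torsion gam y ->
  mon_torsion gam (x + y).
Proof.
move=> [e he] [e' he']; exists (e + e')%N => h; rewrite mulmnDr mpolyXD scalerDr.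
by rewrite {1}mulrC -!scalerA he he' !scaler0 addr0.
Qed.

Lemma mon_torsionZ (a : S) x : mon_torsion gam x -> mon_torsion gam (a *: x).
Proof.
by move=> [e he]; exists e => h; rewrite scalerA mulrC -scalerA he scaler0.
Qed.

Lemma mon_torsionN x : mon_torsion gam x -> mon_torsion gam (- x).
Proof. by rewrite -scaleN1r; exact: mon_torsionZ. Qed.

Lemma mon_torsion_kboundary (f : 'I_s -> S) (y : {set 'I_s} -> M) A :
  (forall B, mon_torsion gam (y B)) -> mon_torsion gam (kboundary f y A).
Proof.
move=> hy; rewrite /kboundary; elim/big_ind: _ => //.
- exact: mon_torsion0.
- exact: mon_torsionD.
- by move=> h _; exact: mon_torsionZ.
Qed.

End MonomialTorsion.

Lemma mon_torsion_hom (k : fieldType) (n s : nat) (gam : 'I_s -> 'X_{1..n})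
    (M N : lmodType {mpoly k[n]}) (F : {linear M -> N}) x :
  mon_torsion gam x -> mon_torsion gam (F x).
Proof. by move=> [e he]; exists e => h; rewrite -linearZ he linear0. Qed.

(** Dependent choice, with values in a type that varies with the index. *)
Lemma dependent_sequence (T : nat -> Type) (P : forall i, T i -> Prop)
    (R : forall i, T i -> T i.+1 -> Prop) (t0 : T 0%N) :
  P 0%N t0 -> (forall i t, P i t -> exists t', P i.+1 t' /\ R i t t') ->
  exists u : forall i, T i, u 0%N = t0 /\ forall i, R i (u i) (u i.+1).
Proof.
move=> P0 step.
pose next i (t : {t : T i | P i t}) := cid (step i (sval t) (svalP t)).
pose rec := nat_rect (fun i => {t : T i | P i t}) (exist _ t0 P0)
  (fun i t => exist _ (sval (next i t)) (proj1 (svalP (next i t)))).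
exists (fun i => sval (rec i)); split=> // i.
exact: (proj2 (svalP (next i (rec i)))).
Qed.

Section Comparison.
Variables (k : fieldType) (d n : nat) (b : 'M[int]_(d, n)) (M : gr_module k b).
Local Notation S := {mpoly k[n]}.

Lemma res_diff_aug (I : inj_resolution M) x : res_diff I 0 (res_aug I x) = 0.
Proof. by apply/res_exact0; exists x. Qed.

Lemma res_diffK (I : inj_resolution M) i x :
  res_diff I i.+1 (res_diff I i x) = 0.
Proof. by apply/res_exactS; exists x. Qed.

(** The invariant [P] says that [phi] maps cocycles to cocycles, which is what
    [injective_extension] requires for the next map. *)
Lemma resolution_chain_map (I J : inj_resolution M) :
  exists phi : forall i, gr_hom (I i) (J i),
    (forall x, phi 0%N (res_aug I x) = res_aug J x) /\
    (forall i x, phi i.+1 (res_diff I i x) = res_diff J i (phi i x)).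
Proof.
have [|phi0 h0] := injective_extension (f := res_aug I) (g := res_aug J) (res_inj (i := 0)).
  move=> u e; have -> : u = 0 by apply: (@res_aug_inj _ _ _ _ _ I); rewrite e linear0.
  exact: linear0.
pose P i (phi : gr_hom (I i) (J i)) :=
  forall x, res_diff I i x = 0 -> res_diff J i (phi x) = 0.
pose R i (phi : gr_hom (I i) (J i)) (phi' : gr_hom (I i.+1) (J i.+1)) :=
  forall x, phi' (res_diff I i x) = res_diff J i (phi x).
have P0 : P 0%N phi0.
  by move=> x /res_exact0[y <-]; rewrite h0 res_diff_aug.
have [i phi hphi|phi [e hR]] := dependent_sequence (R := R) P0; last first.
  by exists phi; split=> [x|//]; rewrite e.
have [|phi' hphi'] := injective_extension (f := res_diff I i)
  (g := comp_hom (res_diff J i) phi) (res_inj (i := i.+1)); first exact: hphi.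
exists phi'; split=> [x /res_exactS[y <-]|x]; rewrite hphi' //=.
exact: res_diffK.
Qed.

(** The invariant [P] says that [chi - d h] vanishes on cocycles, so that it
    factors through the next differential. *)
Lemma resolution_homotopy (I : inj_resolution M) (chi : forall i, gr_hom (I i) (I i)) :
  (forall x, chi 0%N (res_aug I x) = 0) ->
  (forall i x, chi i.+1 (res_diff I i x) = res_diff I i (chi i x)) ->
  exists h : forall i, gr_hom (I i.+1) (I i),
    (forall x, chi 0%N x = h 0%N (res_diff I 0 x)) /\
    (forall i x, chi i.+1 x = res_diff I i (h i x) + h i.+1 (res_diff I i.+1 x)).
Proof.
move=> chi0 chiS.
have [|h0 e0] := injective_extension (f := res_diff I 0) (g := chi 0%N) (res_inj (i := 0)).
  by move=> u /res_exact0[y <-].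
pose g i (h : gr_hom (I i.+1) (I i)) := sub_hom (chi i.+1) (comp_hom (res_diff I i) h).
pose P i (h : gr_hom (I i.+1) (I i)) := forall x, res_diff I i.+1 x = 0 -> g i h x = 0.
pose R i (h : gr_hom (I i.+1) (I i)) (h' : gr_hom (I i.+2) (I i.+1)) :=
  forall x, h' (res_diff I i.+1 x) = g i h x.
have P0 : P 0%N h0.
  by move=> x /res_exactS[y <-]; rewrite /= chiS e0 subrr.
have [i h hP|h [e hR]] := dependent_sequence (R := R) P0; last first.
  by exists h; rewrite e; split=> [x|i x]; rewrite ?e0 // hR addrC subrK.
have [|h' eh'] := injective_extension (f := res_diff I i.+1) (g := g i h) (res_inj (i := i.+1)).
  exact: hP.
exists h'; split=> [x /res_exactS[y <-]|x]; last exact: eh'.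
by rewrite /= chiS eh' /= linearB res_diffK subr0 subrr.
Qed.

(** Any two injective resolutions are homotopy equivalent, and morphisms
    preserve torsion elements. *)
Lemma torsion_cohomology_independent (Delta : {set {set 'I_n}}) (s : nat)
    (sigma : 'I_s -> {set 'I_n}) :
  (forall h, sigma h \in Delta) ->
  (forall tau, tau \in Delta -> exists h, tau \subset sigma h) ->
  forall (I J : inj_resolution M) i p,
  torsion_cohomology_eq0 Delta I i p -> torsion_cohomology_eq0 Delta J i p.
Proof.
move=> hs hcof I J i p; have tE := torsion_mon_torsion hs hcof.
have [phi [phi0 phiS]] := resolution_chain_map J I.
have [psi [psi0 psiS]] := resolution_chain_map I J.
have [|j x|h [h0 hS]] := resolution_homotopy (I := J)
    (chi := fun j => sub_hom (id_hom (J j)) (comp_hom (psi j) (phi j))).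
- by move=> x; rewrite /= phi0 psi0 subrr.
- by rewrite /= phiS psiS linearB.
case: i => [|i] van x tx px dx.
  have phix : phi 0%N x = 0.
    apply: van; [|exact: gr_homP|by rewrite -phiS dx linear0].
    by apply/tE/mon_torsion_hom/tE.
  by have := h0 x; rewrite /= phix linear0 subr0 dx linear0.
have [] := van (phi i.+1 x).
- by apply/tE/mon_torsion_hom/tE.
- exact: gr_homP.
- by rewrite -phiS dx linear0.
move=> w [tw pw dw]; exists (psi i w + h i x); split.
- apply/tE/mon_torsionD; apply/mon_torsion_hom; exact/tE.
- by apply: pieceD; exact: gr_homP.
- have := hS i x; rewrite /= dx linear0 addr0 => e.
  by rewrite linearD -psiS dw -e addrC subrK.
Qed.

End Comparison.

(** * Regular modules are generated by the monomials of a nef degree *)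

Section Chase.
Variables (k : fieldType) (d n s : nat) (b : 'M[int]_(d, n)).
Local Notation S := {mpoly k[n]}.
Local Notation G := (class_group b).
Variables (mu gam : 'I_s -> 'X_{1..n}) (c p : G) (k1 : nat).
Hypothesis mu_deg : forall h, mon_degree b (mu h) = c.
Hypothesis gam_le1 : forall h i, (gam h i <= 1)%N.
Hypothesis mu_le : forall h, (mu h <= gam h *+ k1)%MM.
Local Notation f := (fun h => 'X_[mu h] : S).
Local Notation dg := (fun A : {set 'I_s} => p - c *+ #|A|).
Local Notation tors := (mon_torsion gam).
Implicit Types (A B : {set 'I_s}) (g h : 'I_s).

Lemma eq_kboundary_level (M : lmodType S) (y z : {set 'I_s} -> M) i A :
  #|A| = i -> (forall B, #|B| = i.+1 -> y B = z B) ->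
  kboundary f y A = kboundary f z A.
Proof.
move=> cA yz; apply: eq_bigr => h hA; rewrite yz //.
by rewrite cardsU1 hA cA.
Qed.

(** [kboundary_exact_mod_torsion] in a single homological degree. *)
Lemma kboundary_exact_level (E : gr_module k b) (y : {set 'I_s} -> E) i :
  gr_injective E -> (forall A, #|A| = i -> piece (dg A) (y A)) ->
  (forall A, #|A|.+1 = i -> tors (kboundary f y A)) ->
  exists t z : {set 'I_s} -> E,
    [/\ forall A, piece (dg A) (t A), forall A, piece (dg A) (z A),
        forall A, tors (t A)
      & forall A, #|A| = i -> y A = t A + kboundary f z A].
Proof.
move=> injE hy ty.
pose y' A := if #|A| == i then y A else 0.
have [A|A|t [z [ht hz tt e]]] :=
  kboundary_exact_mod_torsion (p := p) mu_deg gam_le1 mu_le (y := y') injE.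
- by rewrite /y'; case: eqP => [/hy //|_]; exact: piece0.
- have [cA|cA] := eqVneq #|A|.+1 i.
    rewrite (@eq_kboundary_level _ y' y #|A|) // => [|B cB]; first exact: ty.
    by rewrite /y' cB cA eqxx.
  rewrite (@eq_kboundary_level _ y' (fun=> 0) #|A|) // => [|B cB].
    by rewrite /kboundary big1 => [|h _]; [exact: mon_torsion0 | rewrite scaler0].
  by rewrite /y' cB (negPf cA).
exists t, z; split=> // A cA.
by rewrite -e /y' cA eqxx.
Qed.

Variables (Delta : {set {set 'I_n}}) (M : gr_module k b) (I : inj_resolution M).
Hypothesis torsionE : forall (N : lmodType S) (x : N), torsion Delta x <-> tors x.
Hypothesis vanishing : forall i, torsion_cohomology_eq0 Delta I i (p - c *+ i).

(** A diagram chase in the double complex [K_i(I^j)], by descending induction on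
    the Koszul degree; it starts above the length [s] of the Koszul complex, where
    [eta] has no components.  Write [eta = t + bd z] with [t] torsion.  The next
    step applies to [d z] and yields, up to terms of the required form, that [z] is
    a torsion element plus a boundary plus a cocycle for [d], that is a coboundary.
    What remains of [eta] is a torsion cocycle, and it is the coboundary of a
    torsion element because local cohomology vanishes in its degree. *)
Lemma koszul_chase i (eta : {set 'I_s} -> I i.+1) :
  (forall A, #|A| = i.+1 -> piece (dg A) (eta A)) ->
  (forall A, #|A| = i.+1 -> res_diff I i.+1 (eta A) = 0) ->
  (forall A, #|A| = i -> tors (kboundary f eta A)) ->
  exists w v : {set 'I_s} -> I i,
    [/\ forall A, tors (w A), forall A, piece (dg A) (w A)
      & forall A, #|A| = i.+1 -> eta A = res_diff I i (w A + kboundary f v A)].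
Proof.
have [j] := ubnP (s - i); elim: j i eta => // j IHj i eta hj peta deta teta.
have [si|lt_is] := leqP s i.
  exists (fun=> 0), (fun=> 0); split=> [A|A|A cA].
  - exact: mon_torsion0.
  - exact: piece0.
  - by have := max_card A; rewrite cA card_ord ltnNge si.
have [A [/teta //]|t [z [pt pz tt e]]] :=
  kboundary_exact_level (res_inj (i := i.+1)) peta.
have [||||w' [v' [tw' pw' e']]] := IHj i.+1 (fun A => res_diff I i.+1 (z A)).
- by move: hj lt_is; lia.
- by move=> A _; exact: gr_homP.
- by move=> A _; exact: res_diffK.
- move=> A cA; rewrite -kboundary_linear.
  have -> : kboundary f z A = eta A - t A by rewrite e // addrAC subrr add0r.
  rewrite linearB deta // sub0r.
  exact/mon_torsionN/mon_torsion_hom.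
pose z' A := z A - (w' A + kboundary f v' A).
have /choice[v hv] : forall A, exists v, #|A| = i.+2 -> res_diff I i v = z' A.
  move=> A; have [cA|cA] := eqVneq #|A| i.+2; last by exists 0 => /eqP; rewrite (negPf cA).
  suff /res_exactS[v hv] : res_diff I i.+1 (z' A) = 0 by exists v.
  by rewrite linearB e' // subrr.
have bz A : #|A| = i.+1 ->
    eta A = t A + kboundary f w' A + res_diff I i (kboundary f v A).
  move=> cA; rewrite e // -addrA kboundary_linear; congr (_ + _).
  rewrite -[kboundary f w' A]addr0 -(kboundaryK f v' A) -!kboundaryD.
  apply: eq_kboundary_level cA _ => B cB.
  by rewrite hv // addrC subrK.
have /choice[w hw] : forall A, exists w, [/\ tors w, piece (dg A) w
    & #|A| = i.+1 -> res_diff I i w = t A + kboundary f w' A].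
  move=> A; have [cA|cA] := eqVneq #|A| i.+1; last first.
    exists 0; split; [exact: mon_torsion0|exact: piece0|].
    by move=> cA'; rewrite cA' eqxx in cA.
  have [|||w [tw pw dw]] := vanishing (i := i.+1) (x := t A + kboundary f w' A).
  - by apply/torsionE/mon_torsionD => //; exact: mon_torsion_kboundary.
  - have <- : dg A = p - c *+ i.+1 by rewrite cA.
    by apply: pieceD => //; exact: kboundary_homog.
  - have := deta A cA; rewrite (bz A cA) linearD res_diffK addr0; exact.
  by exists w; split=> //; [exact/torsionE | rewrite cA].
exists w, v; split=> [A|A|A cA]; [by case: (hw A)|by case: (hw A)|].
by have [_ _ dw] := hw A; rewrite linearD dw // (bz A cA).
Qed.

(** The last step of the chase, for the image of [x] in the resolution: there the
    torsion cocycle is zero since [H_B^0(M)] vanishes in degree [p], and the cocycle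
    in [K_1(I^0)] comes from [K_1(M)]. *)
Lemma generated_by_monomials (x : M) : piece p x ->
  exists m : 'I_s -> M, x = \sum_h f h *: m h.
Proof.
move=> px.
have [|//|t [z [pt pz tt e]]] := kboundary_exact_level (y := fun=> res_aug I x) (i := 0)
  (res_inj (i := 0)).
  by move=> A cA; rewrite cA mulr0n subr0; exact: gr_homP.
have [|||w [v [tw pw e']]] := koszul_chase (eta := fun A => res_diff I 0 (z A)).
- by move=> A _; exact: gr_homP.
- by move=> A _; exact: res_diffK.
- move=> A cA; rewrite -kboundary_linear.
  have -> : kboundary f z A = res_aug I x - t A by rewrite (e A cA) addrAC subrr add0r.
  by rewrite linearB res_diff_aug sub0r; exact/mon_torsionN/mon_torsion_hom.
pose z' A := z A - (w A + kboundary f v A).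
have /choice[m hm] : forall A, exists m, #|A| = 1%N -> res_aug I m = z' A.
  move=> A; have [cA|cA] := eqVneq #|A| 1%N; last by exists 0 => /eqP; rewrite (negPf cA).
  suff /res_exact0[m hm] : res_diff I 0 (z' A) = 0 by exists m.
  by rewrite linearB e' // subrr.
have c0 : #|(set0 : {set 'I_s})| = 0%N by exact: cards0.
have xE : res_aug I x = t set0 + kboundary f w set0 + res_aug I (kboundary f m set0).
  rewrite (e _ c0) -addrA kboundary_linear; congr (_ + _).
  rewrite -[kboundary f w _]addr0 -(kboundaryK f v set0) -!kboundaryD.
  apply: eq_kboundary_level c0 _ => B cB.
  by rewrite hm // addrC subrK.
have t0 : t set0 + kboundary f w set0 = 0.
  apply: (vanishing (i := 0)).
  - by apply/torsionE/mon_torsionD => //; exact: mon_torsion_kboundary.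
  - have <- : dg set0 = p - c *+ 0 by rewrite c0.
    by apply: pieceD => //; exact: kboundary_homog.
  - have := res_diff_aug I x; rewrite xE linearD res_diff_aug addr0; exact.
exists (fun h => ksign k n h set0 *: m [set h]).
rewrite t0 add0r in xE; rewrite (res_aug_inj xE).
apply: eq_big => [h|h _]; first by rewrite inE.
by rewrite setU0 scalerA mulrC.
Qed.

End Chase.

(** * Cones of a complete smooth fan *)

Section FanGeometry.
Variables (d n : nat) (b : 'M[int]_(d, n)) (Delta : {set {set 'I_n}}).
Local Notation pairing := (pairing b).
Local Notation ray i := (map_mx intr (col i b) : 'cV[rat]_d).

Definition rat_pairing (u : 'cV[int]_d) (v : 'cV[rat]_d) : rat :=
  ((map_mx intr u)^T *m v) 0 0.

Fact rat_pairing_linear u : linear_for *%R (rat_pairing u).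
Proof. by move=> a v w; rewrite /rat_pairing mulmxDr -scalemxAr !mxE. Qed.

HB.instance Definition _ u :=
  GRing.isLinear.Build rat 'cV[rat]_d rat *%R (rat_pairing u) (rat_pairing_linear u).

Lemma rat_pairing_ray u i : rat_pairing u (ray i) = (pairing u i)%:~R.
Proof.
rewrite /rat_pairing /Defs.pairing !mxE rmorph_sum; apply: eq_bigr => j _.
by rewrite !mxE rmorphM.
Qed.

Definition dual_to (sigma : {set 'I_n}) (e : 'I_n -> 'cV[int]_d) :=
  {in sigma &, forall i j, pairing (e i) j = (i == j)}.

Lemma rat_pairing_comb u (P : pred 'I_n) (a : 'I_n -> rat) :
  rat_pairing u (\sum_(i | P i) a i *: ray i) = \sum_(i | P i) a i * (pairing u i)%:~R.
Proof. by rewrite linear_sum; apply: eq_bigr => i _; rewrite linearZ /= rat_pairing_ray. Qed.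

Lemma dual_coord (sigma tau : {set 'I_n}) e (a : 'I_n -> rat) i : dual_to sigma e ->
  tau \subset sigma -> i \in sigma ->
  rat_pairing (e i) (\sum_(j in tau) a j *: ray j) = if i \in tau then a i else 0.
Proof.
move=> de ts si; rewrite rat_pairing_comb; case: ifPn => hi.
  rewrite (bigD1 i) //= de // eqxx mulr1 big1 ?addr0 // => j /andP[hj /negPf ji].
  by rewrite de ?(subsetP ts) // eq_sym ji mulr0.
apply: big1 => j hj; rewrite (de i j si (subsetP ts j hj)).
by have /negPf -> : i != j; rewrite ?mulr0 //; apply: contraNneq hi => ->.
Qed.

Hypothesis smooth : is_smooth_fan b Delta.

Lemma card_cone (sigma : {set 'I_n}) : sigma \in Delta -> (#|sigma| <= d)%N.
Proof.
move=> /(fan_smooth smooth)[U [f [_ finj _]]].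
by rewrite -(card_in_imset finj) -[X in (_ <= X)%N]card_ord max_card.
Qed.

Lemma cone_coordinates (sigma : {set 'I_n}) : sigma \in Delta ->
  exists U f, [/\ forall v, \sum_j rat_pairing (U j) v *: f j = v,
    (forall j j', rat_pairing (U j) (f j') = (j == j')%:R) &
    exists2 g : 'I_n -> 'I_d, {in sigma &, injective g} &
      {in sigma, forall i, ray i = f (g i)}].
Proof.
move=> /(fan_smooth smooth)[U [g [unitU ginj Ug]]].
pose V := map_mx intr U : 'M[rat]_d; pose W := map_mx intr (invmx U) : 'M[rat]_d.
have WV : W *m V = 1%:M by rewrite -map_mxM mulVmx // map_mx1.
have VW : V *m W = 1%:M by rewrite -map_mxM mulmxV // map_mx1.
have fE j v : rat_pairing ((row j (invmx U))^T) v = (W *m v) j 0.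
  by rewrite /rat_pairing !mxE; apply: eq_bigr => i _; rewrite !mxE.
exists (fun j => (row j (invmx U))^T), (fun j => col j V); split.
- move=> v; rewrite -[RHS]mul1mx -VW -mulmxA; apply/colP => i; rewrite summxE mxE.
  by apply: eq_bigr => j _; rewrite fE !mxE mulrC.
- by move=> j j'; rewrite fE colE mulmxA WV mul1mx !mxE andbT.
- by exists g => // i /Ug ->; apply/colP => j; rewrite !mxE.
Qed.

Lemma dual_basis (sigma : {set 'I_n}) : sigma \in Delta ->
  exists2 e, dual_to sigma e & #|sigma| = d ->
    forall v, v = \sum_(i in sigma) rat_pairing (e i) v *: ray i.
Proof.
move=> /cone_coordinates[U [f [fU Uf [g ginj gf]]]].
exists (fun i => U (g i)) => [i j si sj|cs v].
  have := Uf (g i) (g j); rewrite -gf // rat_pairing_ray (inj_in_eq ginj) // => e.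
  by apply: (@intr_inj rat); rewrite e; case: (i == j).
have gT : g @: sigma = [set: 'I_d].
  by apply/eqP; rewrite eqEcard subsetT cardsT card_ord card_in_imset // cs leqnn.
rewrite -{1}[v]fU (eq_bigl (fun j => j \in g @: sigma)) => [|j]; last by rewrite gT inE.
by rewrite big_imset //=; apply: eq_bigr => i /gf ->.
Qed.

Lemma cone_not_spanning (sigma : {set 'I_n}) : sigma \in Delta -> (#|sigma| < d)%N ->
  exists u v, {in sigma, forall i, pairing u i = 0} /\ rat_pairing u v = 1.
Proof.
move=> /cone_coordinates[U [f [fU Uf [g ginj gf]]]] cs.
have [j gj] : exists j, j \notin g @: sigma.
  apply/existsP; apply: contraT => /existsPn gT.
  have : [set: 'I_d] \subset g @: sigma by apply/subsetP => j _; rewrite -[_ \in _]negbK gT.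
  by move/subset_leq_card; rewrite cardsT card_ord card_in_imset // leqNgt cs.
exists (U j), (f j); split; last by rewrite Uf eqxx.
move=> i si; apply: (@intr_inj rat); rewrite -rat_pairing_ray gf // Uf.
by case: eqP => // e; rewrite e imset_f in gj.
Qed.

Hypothesis complete : complete_fan b Delta.

Lemma complete_pairing_ge0 (u : 'cV[int]_d) : (forall i, 0 <= pairing u i) -> u = 0.
Proof.
move=> hu; apply/colP => j; rewrite mxE.
have [sigma _ [a a0 e]] := complete (- map_mx intr u).
have : 0 <= rat_pairing u (- map_mx intr u).
  by rewrite e rat_pairing_comb; apply: sumr_ge0 => i _; rewrite mulr_ge0 // ler0z.
rewrite linearN /= oppr_ge0 /rat_pairing mxE => le0.
have ge0 : forall i, true -> 0 <= (map_mx intr u)^T 0 i * (map_mx intr u) i 0 :> rat.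
  by move=> i _; rewrite !mxE -expr2 sqr_ge0.
have /eqP : \sum_i (map_mx intr u)^T 0 i * (map_mx intr u) i 0 = 0 :> rat.
  by apply/eqP; rewrite eq_le le0 sumr_ge0.
rewrite psumr_eq0 // => /allP/(_ j (mem_index_enum _)) /=.
by rewrite !mxE mulf_eq0 orbb intr_eq0 => /eqP.
Qed.

(** One of the finitely many cones contains the points [w + v / N] for infinitely
    many [N].  It is closed, so it contains [w], and then it contains [tau], as
    [w] is in the relative interior of [tau]. *)
Lemma cone_towards (tau : {set 'I_n}) v : tau \in Delta ->
  exists rho (eps : rat), [/\ rho \in Delta, tau \subset rho, 0 < eps
    & in_cone b rho (\sum_(h in tau) ray h + eps *: v)].
Proof.
move=> hT; pose w : 'cV[rat]_d := \sum_(h in tau) ray h.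
pose eps N : rat := N.+1%:R^-1.
have eps_gt0 N : 0 < eps N by rewrite invr_gt0 ltr0n.
have /choice[rho hrho] : forall N, exists rho, rho \in Delta /\ in_cone b rho (w + eps N *: v).
  by move=> N; have [rho] := complete (w + eps N *: v); exists rho.
have [r hr] : exists r, forall N, exists2 N', (N <= N')%N & rho N' = r.
  apply: contrapT => /forallNP none.
  have /choice[B hB] : forall r, exists B, forall N, (B <= N)%N -> rho N <> r.
    move=> r; have /existsNP[B hB] := none r; exists B => N BN e; apply: hB.
    by exists N.
  exact: (hB (rho (\max_r B r)%N) _ (leq_bigmax _)).
have rD : r \in Delta by have [N _ <-] := hr 0%N; have [] := hrho N.
have hin N : rho N = r -> in_cone b r (w + eps N *: v) by move=> <-; have [] := hrho N.
have [e de _] := dual_basis rD.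
(* [pr x = x] exactly for [x] in the linear span of the cone [r]. *)
pose pr (x : 'cV[rat]_d) := \sum_(i in r) rat_pairing (e i) x *: ray i.
have prE x : in_cone b r x -> pr x = x.
  move=> [a _ ->]; apply: eq_bigr => i ri.
  by rewrite (dual_coord a de (subxx _) ri) ri.
have prD x y c : pr (x + c *: y) = pr x + c *: pr y.
  rewrite /pr scaler_sumr -big_split; apply: eq_bigr => i _ /=.
  by rewrite linearD linearZ scalerDl scalerA.
have prw : pr w = w.
  have [N1 _ e1] := hr 0%N; have [N2 lt12 e2] := hr N1.+1.
  have := prE _ (hin _ e1).
  have := prE _ (hin _ e2).
  rewrite !prD => /eqP E2 /eqP E1.
  have shift x : pr w + x *: pr v == w + x *: v -> x *: (pr v - v) = w - pr w.
    move=> /eqP E; apply/eqP.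
    by rewrite scalerBr subr_eq addrAC -E addrAC subrr add0r.
  have ne : eps N1 - eps N2 != 0.
    by rewrite subr_eq0 (inj_eq invr_inj) eqr_nat eqSS neq_ltn lt12.
  have /eqP : (eps N1 - eps N2) *: (pr v - v) = 0.
    by rewrite scalerBl !shift // subrr.
  rewrite scaler_eq0 (negPf ne) => /eqP ev.
  by have /eqP := shift _ E1; rewrite ev scaler0 eq_sym subr_eq0 => /eqP.
have w0 i : i \in r -> 0 <= rat_pairing (e i) w.
  move=> ri; rewrite leNgt; apply/negP => neg.
  pose beta := rat_pairing (e i) v.
  have [N le er] := hr (Num.truncn (beta / - rat_pairing (e i) w)).
  have [a a0 ea] := hin _ er.
  have := a0 i; rewrite -[a i](_ : rat_pairing (e i) (w + eps N *: v) = _); last first.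
    by rewrite ea (dual_coord a de (subxx _) ri) ri.
  rewrite linearD linearZ /= -/beta leNgt => /negP[].
  rewrite -ltrBrDl sub0r /eps ltr_pdivrMl ?ltr0n // -ltr_pdivrMr ?oppr_gt0 //.
  by apply: lt_le_trans (truncnS_gt _) _; rewrite ler_nat.
have tau_r : tau \subset r.
  apply/subsetP => h hh; apply: contraT => hr'.
  have [f df _] := dual_basis hT.
  have wt : w = \sum_(i in tau) (fun=> 1) i *: ray i.
    by apply: eq_bigr => i _; rewrite scale1r.
  have [||a _ ea] := fan_inter smooth (v := w) hT rD.
  - by exists (fun=> 1).
  - exists (fun i => if i \in r then rat_pairing (e i) w else 0) => [i|].
      by case: ifP => // /w0.
    by rewrite -{1}prw; apply: eq_bigr => i ->.
  have := dual_coord (fun=> 1) df (subxx _) hh; rewrite hh -wt ea.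
  rewrite (dual_coord a df (subsetIl _ _) hh) inE (negPf hr') andbF => /esym/eqP.
  by rewrite oner_eq0.
have [N _ er] := hr 0%N; exists r, (eps N); split=> //.
exact: hin.
Qed.

(** Move from an interior point of [sigma] in a direction outside its span: by
    [cone_towards] this enters a larger cone. *)
Lemma maximal_cone (sigma : {set 'I_n}) : sigma \in Delta ->
  exists rho, [/\ rho \in Delta, sigma \subset rho & #|rho| = d].
Proof.
have [m] := ubnP (d - #|sigma|); elim: m sigma => // m IHm sigma hm hs.
have := card_cone hs; rewrite leq_eqVlt => /orP[/eqP cs|cs]; first by exists sigma.
have [u [v [us uv]]] := cone_not_spanning hs cs.
have [rho [eps [hr sr eps0 [a _ ea]]]] := cone_towards v hs.
have [e|ne] := eqVneq sigma rho.
  have := congr1 (rat_pairing u) ea; rewrite -e rat_pairing_comb [RHS]big1 => [|i hi]; last first.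
    by rewrite us // mulr0.
  rewrite linearD linearZ /= uv mulr1 linear_sum big1 => [/eqP|i hi].
    by rewrite add0r gt_eqF.
  by rewrite /= rat_pairing_ray us.
have lt : (#|sigma| < #|rho|)%N by rewrite proper_card // properEneq ne.
have [||rho' [h1 h2 h3]] := IHm rho; [|by []|].
  by have := card_cone hr; move: hm lt cs; lia.
by exists rho'; split=> //; exact: subset_trans sr h2.
Qed.

End FanGeometry.

(** * Nef divisors are generated by global sections *)

Section NefDivisors.
Variables (d n : nat) (b : 'M[int]_(d, n)) (Delta : {set {set 'I_n}}).
Local Notation pairing := (pairing b).
Local Notation ray i := (map_mx intr (col i b) : 'cV[rat]_d).
Hypothesis smooth : is_smooth_fan b Delta.
Hypothesis complete : complete_fan b Delta.
Implicit Types (sigma rho : {set 'I_n}) (e : 'I_n -> 'cV[int]_d) (E : 'I_n -> rat).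

(** On the cone [sigma] this is the support function of the divisor [E], up to
    sign. *)
Definition support_form sigma e E (v : 'cV[rat]_d) : rat :=
  \sum_(i in sigma) E i * rat_pairing (e i) v.

Fact support_form_linear sigma e E : linear_for *%R (support_form sigma e E).
Proof.
move=> a v w; rewrite /support_form mulr_sumr -big_split; apply: eq_bigr => i _ /=.
by rewrite linearP mulrDr mulrCA.
Qed.

HB.instance Definition _ sigma e E := GRing.isLinear.Build rat 'cV[rat]_d rat *%R
  (support_form sigma e E) (support_form_linear sigma e E).

(** The degree of the divisor [E] on the relation that expresses the [j]-th ray
    in the basis [sigma]; it is nonnegative for all [sigma] and [j] when [E] is
    generated by global sections. *)
Definition defect sigma e E j : rat := E j - support_form sigma e E (ray j).

Lemma defectE sigma e E j :
  defect sigma e E j = E j - \sum_(i in sigma) E i * (pairing (e i) j)%:~R.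
Proof. by congr (_ - _); apply: eq_bigr => i _; rewrite rat_pairing_ray. Qed.

Lemma support_form_comb sigma e E (P : pred 'I_n) (a : 'I_n -> rat) :
  support_form sigma e E (\sum_(h | P h) a h *: ray h) =
  \sum_(h | P h) a h * E h - \sum_(h | P h) a h * defect sigma e E h.
Proof.
rewrite linear_sum -sumrB; apply: eq_bigr => h _.
by rewrite linearZ /= -mulrBr /defect opprB addrC subrK.
Qed.

Lemma defect_in sigma e E j : dual_to b sigma e -> j \in sigma -> defect sigma e E j = 0.
Proof.
move=> de sj; rewrite defectE (bigD1 j) //= de // eqxx mulr1 big1 ?addr0 ?subrr //.
by move=> i /andP[si /negPf ij]; rewrite de // ij mulr0.
Qed.

(** Otherwise the ray of [j] would lie in [sigma], but it meets [sigma] in a common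
    face. *)
Lemma neg_coordinate sigma e j : sigma \in Delta -> dual_to b sigma e ->
  (forall v, v = \sum_(i in sigma) rat_pairing (e i) v *: ray i) ->
  j \notin sigma -> exists2 i, i \in sigma & pairing (e i) j < 0.
Proof.
move=> hs de span jNs.
have jD := fan_rays smooth j.
have [f df _] := dual_basis smooth jD.
apply: contrapT => no.
have [||a _ ea] := fan_inter smooth (v := ray j) hs jD.
- exists (fun i => if i \in sigma then rat_pairing (e i) (ray j) else 0) => [i|].
    case: ifP => // si; rewrite rat_pairing_ray ler0z leNgt; apply/negP => neg.
    by apply: no; exists i.
  by rewrite {1}[ray j]span; apply: eq_bigr => i ->.
- by exists (fun=> 1) => //; rewrite big_set1 scale1r.
have := rat_pairing_ray b (f j) j; rewrite ea df ?inE // eqxx big1 ?linear0 => [/eqP|i].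
  by rewrite eq_sym oner_eq0.
by rewrite !inE => /andP[si /eqP e']; rewrite -e' si in jNs.
Qed.

Lemma neg_unit_int (x y : int) : x * y = 1 -> y < 0 -> y = -1.
Proof. by move=> /(congr1 absz)/eqP; rewrite abszM muln_eq1 => /andP[_ /eqP]; lia. Qed.

(** If the globally convex function of [E] is linear on the hull of [sigma] and of
    another ray, then it is linear across a facet of [sigma] that separates
    [sigma] from this ray: near this facet, the cone on its other side meets the
    hull. *)
Lemma degenerate_wall sigma e E j :
  (forall rho f, rho \in Delta -> #|rho| = d -> dual_to b rho f ->
     forall h, 0 <= defect rho f E h) ->
  sigma \in Delta -> #|sigma| = d -> dual_to b sigma e ->
  (forall v, v = \sum_(i in sigma) rat_pairing (e i) v *: ray i) ->
  j \notin sigma -> defect sigma e E j = 0 ->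
  exists i i', [/\ i \in sigma, i' \notin sigma, i' |: (sigma :\ i) \in Delta,
    pairing (e i) i' = -1 & defect sigma e E i' = 0].
Proof.
move=> convex hs cs de span jNs dj.
have [i si neg] := neg_coordinate hs de span jNs.
pose tau := sigma :\ i.
have tauD : tau \in Delta by apply: fan_faces smooth _ _ hs _; exact: subD1set.
(* The cone on the other side of the facet [tau], in the direction of [j]. *)
have [rho [eps [rhoD tr eps0 [a a0 ea]]]] := cone_towards smooth complete (ray j) tauD.
have comb : \sum_(h in tau) ray h = \sum_(h in tau) (fun=> 1) h *: ray h.
  by apply: eq_bigr => h _; rewrite scale1r.
have [i' ri' neg'] : exists2 i', i' \in rho & a i' * (pairing (e i) i')%:~R < 0.
  apply: contrapT => no; have := rat_pairing_comb b (e i) (mem rho) a; rewrite -ea.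
  rewrite linearD linearZ /= rat_pairing_ray comb rat_pairing_comb big1 => [|h]; last first.
    by rewrite !inE => /andP[/negPf hi sh]; rewrite de // eq_sym hi mulr0.
  rewrite add0r => E1; have : eps * (pairing (e i) j)%:~R < 0.
    by rewrite pmulr_rlt0 // ltrz0.
  rewrite E1 ltNge sumr_ge0 // => h rh; rewrite leNgt; apply/negP => lt.
  by apply: no; exists h.
have ai' : 0 < a i'.
  by rewrite lt_neqAle a0 andbT; apply: contraTneq neg' => <-; rewrite mul0r ltxx.
rewrite pmulr_rlt0 // ltrz0 in neg'.
have sNi' : i' \notin sigma by apply: contraTN neg' => si'; rewrite de //; case: eqP.
have rhoE : rho = i' |: tau.
  apply/eqP; rewrite eq_sym eqEcard subUset sub1set ri' tr /= cardsU1.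
  rewrite !inE (negPf sNi') andbF; apply: leq_trans (card_cone smooth rhoD) _.
  by rewrite -{1}cs (cardsD1 i sigma) si.
have cr : #|rho| = d.
  by rewrite rhoE cardsU1 !inE (negPf sNi') andbF -cs (cardsD1 i sigma) si.
have [f df /(_ cr) spanr] := dual_basis smooth rhoD.
(* The change of basis from [rho] to [sigma] is integral in both directions, so
   this coordinate is a unit. *)
have ei' : pairing (e i) i' = -1.
  apply: (@neg_unit_int (pairing (f i') i)) => //; apply: (@intr_inj rat).
  have := rat_pairing_ray b (e i) i; rewrite {1}[ray i]spanr rat_pairing_comb.
  rewrite (bigD1 i') //= big1 ?addr0 => [|h /andP[]].
    by rewrite rat_pairing_ray (de i i) // eqxx rmorphM.
  rewrite rhoE !inE => /orP[->//|/andP[/negPf hi sh] _].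
  by rewrite (de i h) // eq_sym hi mulr0.
exists i, i'; split=> //; first by rewrite -rhoE.
(* Evaluate the linear forms of [sigma] and of [rho] at the point of [rho] that was
   found above: convexity bounds the difference of the values from both sides. *)
have := support_form_comb sigma e E (mem rho) a.
have := support_form_comb rho f E (mem rho) a.
rewrite [X in _ - X]big1 => [|h rh]; last by rewrite defect_in ?mulr0.
rewrite subr0 -ea !linearD !linearZ /= comb !support_form_comb.
rewrite [X in _ - X]big1 => [|h th]; last by rewrite defect_in ?mulr0 // (subsetP tr).
rewrite [X in _ - X + eps * support_form sigma _ _ _]big1 => [|h]; last first.
  by rewrite !inE => /andP[_ sh]; rewrite defect_in ?mulr0.
have -> : support_form sigma e E (ray j) = E j.
  by move/eqP: dj; rewrite subr_eq0 => /eqP.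
have -> : support_form rho f E (ray j) = E j - defect rho f E j.
  by rewrite /defect opprB addrC subrK.
move=> e1 e2; have dj0 := mulr_ge0 (ltW eps0) (convex rho f rhoD cr df j).
have ge0 h : true -> 0 <= (if h \in rho then a h * defect sigma e E h else 0).
  by move=> _; case: ifP => // _; rewrite mulr_ge0 ?convex.
have : \sum_h (if h \in rho then a h * defect sigma e E h else 0) = 0.
  apply/eqP; rewrite eq_le sumr_ge0 // andbT -big_mkcond /=.
  by move: e1 e2 dj0; lra.
move=> /eqP; rewrite psumr_eq0 // => /allP/(_ i' (mem_index_enum _)) /=.
by rewrite ri' mulf_eq0 gt_eqF //= => /eqP.
Qed.

(** The wall relation is the expression of the new ray in the basis [sigma], so
    the degree of a divisor on the curve of the wall is a defect. *)
Lemma wall_relation_of sigma e i i' :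
  sigma \in Delta -> #|sigma| = d -> dual_to b sigma e ->
  (forall v, v = \sum_(i in sigma) rat_pairing (e i) v *: ray i) ->
  i \in sigma -> i' \notin sigma -> i' |: (sigma :\ i) \in Delta ->
  pairing (e i) i' = -1 ->
  wall_relation b Delta (sigma :\ i) i' i
    (\col_h ((h == i')%:Z - (if h \in sigma then pairing (e h) i' else 0))).
Proof.
move=> hs cs de span si sNi' wD ei'.
have nii' : i != i' by apply: contraNneq sNi' => <-.
split.
- by split; rewrite ?inE ?eqxx ?(negPf sNi') ?andbF // 1?eq_sym // -cs (cardsD1 i sigma) si.
- by rewrite setD1K.
- by rewrite !mxE eqxx (negPf sNi') si ei' (negPf nii').
- move=> h; rewrite !inE !negb_or => /and3P[/negPf hi' hi]; rewrite hi /= => /negPf hsN.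
  by rewrite mxE hi' hsN.
apply/colP => x; apply: (@intr_inj rat); rewrite !mxE rmorph_sum /=.
under eq_bigr => h _ do rewrite !mxE rmorphM rmorphB mulrBr /=.
rewrite sumrB (bigD1 i') //= eqxx mulr1 big1 ?addr0 => [|h /negPf ->]; last by rewrite mulr0.
have := congr1 (fun v : 'cV[rat]_d => v x 0) (span (ray i')).
rewrite /= !mxE summxE => ->; apply/eqP; rewrite subr_eq0 big_mkcond; apply/eqP.
apply: eq_bigr => h _; case: ifP => _; last by rewrite mulr0.
by rewrite !mxE rat_pairing_ray mulrC.
Qed.

Lemma strictly_convex_defect sigma e (A : 'cV[int]_n) j :
  strictly_convex b Delta A -> sigma \in Delta -> #|sigma| = d ->
  (forall v, v = \sum_(i in sigma) rat_pairing (e i) v *: ray i) ->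
  j \notin sigma -> 0 < defect sigma e (fun i => (A i 0)%:~R) j.
Proof.
move=> convA hs cs span jNs; have [u [us uN]] := convA sigma hs cs.
rewrite defectE subr_gt0 -ltrN2 -rmorphN /=.
have := rat_pairing_ray b u j; rewrite {1}[ray j]span rat_pairing_comb.
rewrite (eq_bigr (fun i => - ((A i 0)%:~R * (pairing (e i) j)%:~R))) => [|i si]; last first.
  by rewrite us // rat_pairing_ray rmorphN mulrN mulrC.
by rewrite sumrN => ->; rewrite ltr_int uN.
Qed.

Lemma dual_unique sigma e f E v : sigma \in Delta -> #|sigma| = d ->
  dual_to b sigma e -> dual_to b sigma f -> support_form sigma e E v = support_form sigma f E v.
Proof.
move=> hs cs de df; have [g dg /(_ cs) span] := dual_basis smooth hs.
have coord h i : dual_to b sigma h -> i \in sigma -> rat_pairing (h i) v = rat_pairing (g i) v.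
  by move=> dh si; rewrite {1}[v]span (dual_coord _ dh (subxx _) si) si.
by apply: eq_bigr => i si; rewrite (coord e) // (coord f).
Qed.

Lemma defectD sigma e E E' (t : rat) j :
  defect sigma e (fun i => E i + t * E' i) j = defect sigma e E j + t * defect sigma e E' j.
Proof.
rewrite !defectE mulrBr mulr_sumr addrACA -opprD -big_split; congr (_ - _).
by apply: eq_bigr => i _; rewrite mulrDl mulrA.
Qed.

(** Toric Kleiman criterion: a divisor [D] that is nonnegative on the invariant
    curves is generated by global sections.  Otherwise let [t > 0] be the least
    number for which [D + t A] is globally convex, where [A] is ample.  Then
    [D + t A] is positive on all invariant curves, but it is zero on some
    other relation, which contradicts [degenerate_wall]. *)
Lemma nef_defect_ge0 sigma e (A D : 'cV[int]_n) j :
  strictly_convex b Delta A -> nef_divisor b Delta D ->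
  sigma \in Delta -> #|sigma| = d -> dual_to b sigma e ->
  0 <= defect sigma e (fun i => (D i 0)%:~R) j.
Proof.
move=> convA nefD hs cs de; rewrite leNgt; apply/negP => neg.
have /choice[f hf] : forall rho, exists f, rho \in Delta -> dual_to b rho f /\
    (#|rho| = d -> forall v, v = \sum_(i in rho) rat_pairing (f i) v *: ray i).
  move=> rho; have [hr|_] := boolP (rho \in Delta); last by exists (fun=> 0).
  by have [g dg sg] := dual_basis smooth hr; exists g.
pose dD (x : {set 'I_n} * 'I_n) := defect x.1 (f x.1) (fun i => (D i 0)%:~R) x.2.
pose dA (x : {set 'I_n} * 'I_n) := defect x.1 (f x.1) (fun i => (A i 0)%:~R) x.2.
pose P (x : {set 'I_n} * 'I_n) := [&& x.1 \in Delta, #|x.1| == d & x.2 \notin x.1].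
have dA0 x : P x -> 0 < dA x.
  move=> /and3P[x1 /eqP cx x2]; apply: strictly_convex_defect => //.
  exact: (hf _ x1).2.
have negf : dD (sigma, j) < 0.
  by rewrite /dD /defect (dual_unique _ _ hs cs (hf _ hs).1 de).
have Psj : P (sigma, j).
  rewrite /P /= hs cs eqxx; apply/negP => sj.
  by move: negf; rewrite /dD defect_in ?ltxx //; exact: (hf _ hs).1.
case: (@Order.TotalTheory.arg_minP _ _ _ (sigma, j) P (fun x => dD x / dA x) Psj).
move=> [rho h] Px minx; pose t := - (dD (rho, h) / dA (rho, h)).
have t0 : 0 < t.
  rewrite oppr_gt0; apply: le_lt_trans (minx _ Psj) _.
  by rewrite pmulr_llt0 ?invr_gt0 ?dA0.
have [hr /eqP cr hNr] := and3P Px; have [df spanf] := hf _ hr.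
pose E i : rat := (D i 0)%:~R + t * (A i 0)%:~R.
have [||i [i' [ri rNi' wD ei' dE]]] :=
  @degenerate_wall rho (f rho) E h _ hr cr df (spanf cr) hNr.
- move=> tau g hT cT dg i; rewrite /defect (dual_unique _ _ hT cT dg (hf _ hT).1) -/(defect _ _ _ _).
  have [ti|tNi] := boolP (i \in tau); first by rewrite defect_in //; exact: (hf _ hT).1.
  have Pti : P (tau, i) by rewrite /P /= hT cT eqxx.
  rewrite defectD -[X in X + _]/(dD (tau, i)) -[X in _ + _ * X]/(dA (tau, i)).
  have := minx _ Pti; rewrite ler_pdivlMr ?dA0 // => le.
  by rewrite /t mulNr subr_ge0.
- rewrite defectD -[X in X + _]/(dD (rho, h)) -[X in _ + _ * X]/(dA (rho, h)).
  by rewrite /t mulNr divfK ?subrr // gt_eqF ?dA0.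
have := nefD _ _ _ _ (wall_relation_of hr cr df (spanf cr) ri rNi' wD ei').
have -> : \sum_x D x 0 * (\col_y
      ((y == i')%:Z - (if y \in rho then pairing (f rho y) i' else 0))) x 0
    = D i' 0 - \sum_(h1 in rho) D h1 0 * pairing (f rho h1) i'.
  under eq_bigr => x _ do rewrite mxE mulrBr.
  rewrite sumrB (bigD1 i') //= eqxx mulr1 big1 ?addr0 => [|x /negPf ->]; last by rewrite mulr0.
  congr (_ - _); rewrite [RHS]big_mkcond; apply: eq_bigr => x _.
  by case: ifP => _; rewrite ?mulr0.
rewrite -(ler0z rat) rmorphB rmorph_sum /=.
under eq_bigr => x _ do rewrite rmorphM.
rewrite -(defectE rho (f rho) (fun i => (D i 0)%:~R) i') => D0.
have A0 : 0 < dA (rho, i') by apply: dA0; rewrite /P /= hr cr eqxx.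
move: dE; rewrite defectD => /eqP; rewrite gt_eqF //.
by apply: ltr_wpDl => //; exact: mulr_gt0.
Qed.

(** The section that does not vanish at the fixed point of [sigma]: the divisor
    is moved by the character that clears its coefficients on [sigma], and then its
    other coefficients are its defects. *)
Lemma nef_effective_off_cone sigma (A D : 'cV[int]_n) :
  strictly_convex b Delta A -> nef_divisor b Delta D ->
  sigma \in Delta -> #|sigma| = d ->
  exists m : 'X_{1..n}, mon_degree b m = div_class b D /\
    {in sigma, forall i, m i = 0%N}.
Proof.
move=> convA nefD hs cs; have [e de _] := dual_basis smooth hs.
pose u : 'cV[int]_d := - \sum_(i in sigma) D i 0 *: e i.
pose D' : 'cV[int]_n := D + b^T *m u.
have uE j : (b^T *m u) j 0 = - \sum_(i in sigma) D i 0 * pairing (e i) j.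
  rewrite /u mulmxN mxE mulmx_sumr summxE; congr (- _); apply: eq_bigr => i _.
  rewrite -scalemxAr mxE /Defs.pairing; congr (_ * _).
  by rewrite -[b^T *m _]trmxK trmx_mul trmxK mxE.
have D'E j : (D' j 0)%:~R = defect sigma e (fun i => (D i 0)%:~R) j.
  rewrite defectE mxE uE rmorphB rmorph_sum /=; congr (_ - _).
  by apply: eq_bigr => i _; rewrite rmorphM.
have D'0 j : 0 <= D' j 0.
  by rewrite -(ler0z rat) D'E; exact: nef_defect_ge0 convA nefD hs cs de.
pose m i := absz (D' i 0).
exists [multinom m i | i < n]; split=> [|i si]; last first.
  rewrite mnmE /m; suff -> : D' i 0 = 0 by [].
  by apply: (@intr_inj rat); rewrite D'E defect_in.
transitivity (div_class b D').
  by congr div_class; apply/colP => i; rewrite mxE mnmE /m gez0_abs.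
rewrite /D' div_classD -[RHS]addr0; congr (_ + _).
by apply/div_class_eq0; exists u.
Qed.

(** An effective principal divisor is given by a linear form that is nonnegative on
    all rays, hence on the whole space, as the fan is complete. *)
Lemma mon_degree_eq0 (m : 'X_{1..n}) : mon_degree b m = 0 -> m = 0%MM.
Proof.
move=> /div_class_eq0[u eu].
have mE i : (m i)%:Z = pairing u i.
  have := congr1 (fun v : 'cV[int]_n => v i 0) eu; rewrite /= mxE => ->.
  by rewrite /Defs.pairing -[b^T *m u]trmxK trmx_mul trmxK mxE.
have u0 : u = 0 by apply: (complete_pairing_ge0 complete) => i; rewrite -mE.
apply/mnmP => i; rewrite mnm0E; apply/eqP; rewrite -eqz_nat mE u0.
by rewrite /Defs.pairing trmx0 mul0mx mxE.
Qed.

End NefDivisors.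

(** * Minimal generators *)

Lemma minimal_semigroup_generator (G : zmodType) (l : nat) (c : 'I_l -> G)
    (P : G -> Prop) (j : 'I_l) :
  minimal_semigroup_generators c P -> P (c j) /\ c j != 0.
Proof.
move=> minc; have spanT := (minc setT).2 erefl.
split; first apply/spanT.
  exists (fun i => nat_of_bool (i == j)).
  rewrite (bigD1 j) ?inE //= eqxx mulr1n big1 ?addr0 // => i /andP[_ /negPf ->].
  by rewrite mulr0n.
apply/eqP => cj; suff : [set~ j] = setT by move/setP/(_ j); rewrite !inE eqxx.
apply/minc => p; rewrite spanT; split=> -[a ->].
  by exists a; rewrite (bigD1 j) ?inE //= cj mul0rn add0r; apply: eq_bigl => i; rewrite !inE.
exists (fun i => if i == j then 0%N else a i).
rewrite [RHS](bigD1 j) ?inE //= eqxx mulr0n add0r.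
by apply: eq_big => [i|i]; rewrite !inE // => /negPf ->.
Qed.

Section MinimalGenerators.
Variables (k : fieldType) (d n : nat) (b : 'M[int]_(d, n)) (M : gr_module k b).
Local Notation S := {mpoly k[n]}.
Local Notation G := (class_group b).

Lemma lin_spanD (E : M -> Prop) x y : lin_span E x -> lin_span E y -> lin_span E (x + y).
Proof.
move=> [r [hr ->]] [r' [hr' ->]]; exists (r ++ r'); rewrite big_cat; split=> // e.
by rewrite mem_cat => /orP[/hr|/hr'].
Qed.

Lemma lin_spanZ (E : M -> Prop) a x : lin_span E x -> lin_span E (a *: x).
Proof.
move=> [r [hr ->]]; exists [seq (a * e.1, e.2) | e <- r]; split.
  by move=> _ /mapP[e /hr he ->].
by rewrite big_map scaler_sumr; apply: eq_bigr => e _; rewrite scalerA.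
Qed.

Lemma lin_span_mem (E : M -> Prop) x : E x -> lin_span E x.
Proof.
by move=> Ex; exists [:: (1, x)]; rewrite big_seq1 scale1r; split=> // e /[1!inE] /eqP ->.
Qed.

Lemma lin_span_sum (E : M -> Prop) (r : seq (S * M)) :
  (forall e, e \in r -> lin_span E e.2) -> lin_span E (\sum_(e <- r) e.1 *: e.2).
Proof.
elim: r => [|e r IHr] hr; first by exists [::]; rewrite !big_nil.
rewrite big_cons; apply: lin_spanD; first by apply/lin_spanZ/hr; rewrite mem_head.
by apply: IHr => e' he'; apply: hr; rewrite inE he' orbT.
Qed.

Definition monomial_term (t : 'X_{1..n} * k * M) : M := (t.1.2 *: 'X_[t.1.1]) *: t.2.

(** These are the combinations of elements of [E] with coefficients in the ideal
    of the variables, expanded into terms to read off the degrees. *)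
Definition nonconstant_comb (E : M -> Prop) (x : M) := exists L : seq ('X_{1..n} * k * M),
  (forall t, t \in L -> t.1.1 != 0%MM /\ E t.2) /\ x = \sum_(t <- L) monomial_term t.

Lemma nonconstant_comb_sum E (T : Type) (r : seq T) (y : T -> M) (P : pred T) :
  (forall t, P t -> nonconstant_comb E (y t)) ->
  nonconstant_comb E (\sum_(t <- r | P t) y t).
Proof.
move=> hy; elim/big_ind: _ => //; first by exists [::]; rewrite big_nil.
move=> x z [L [hL ->]] [L' [hL' ->]]; exists (L ++ L'); rewrite big_cat; split=> // t.
by rewrite mem_cat => /orP[/hL|/hL'].
Qed.

Lemma nonconstant_combZ (E : M -> Prop) (m : 'X_{1..n}) x :
  m != 0%MM -> lin_span E x -> nonconstant_comb E ('X_[m] *: x).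
Proof.
move=> m0 [r [hr ->]]; rewrite scaler_sumr big_seq; apply: nonconstant_comb_sum => e he.
exists [seq ((m + u)%MM, (e.1@_u : k), e.2) | u <- msupp e.1]; split.
  move=> _ /mapP[u _ ->] /=; split; last exact: hr.
  apply: contra m0 => /eqP/mnmP mu; apply/eqP/mnmP => i; rewrite mnm0E.
  by have := mu i; rewrite mnm0E mnmDE => /eqP; rewrite addn_eq0 => /andP[/eqP].
rewrite scalerA {1}[e.1]mpolyE mulr_sumr scaler_suml [RHS]big_map.
by apply: eq_bigr => u _; rewrite /monomial_term /= mpolyXD -scalerAr.
Qed.

(** A graded Nakayama lemma: in a nonconstant combination of generators with
    the value [x], the terms of the degree of [x] do not involve [x] itself, as
    only the constants have degree zero. *)
Lemma minimal_generator_not_nonconstant_comb (E : M -> Prop) x p :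
  (forall m : 'X_{1..n}, mon_degree b m = 0 -> m = 0%MM) ->
  minimal_homog_generators E -> E x -> piece p x -> ~ nonconstant_comb E x.
Proof.
move=> pointed [homE spanE minE] Ex px [L [hL xE]].
(* An element may be homogeneous of several degrees only if it is zero, but for
   [x] the degree [p] has to be chosen. *)
have /choice[dz hdz] : forall z, exists q, E z -> piece q z /\ (z = x -> q = p).
  move=> z; have [->|zx] := eqVneq z x; first by exists p.
  have [/homE[q pq]|nE] := pselect (E z); last by exists 0.
  by exists q => _; split=> // e; rewrite e eqxx in zx.
pose deg (t : 'X_{1..n} * k * M) : G := mon_degree b t.1.1 + dz t.2.
have hdeg t : t \in L -> piece (deg t) (monomial_term t).
  move=> /hL[_ Et]; apply: pieceZ (hdz _ Et).1 erefl => m /msuppZ_le.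
  exact: homog_polyX.
have xE' := piece_component hdeg px xE.
have xspan : lin_span (fun z => E z /\ z <> x) x.
  exists [seq (t.1.2 *: 'X_[t.1.1], t.2) | t <- L & deg t == p]; split.
    move=> _ /mapP[t + ->] /=; rewrite mem_filter => /andP[/eqP dt tL].
    have [t0 Et] := hL t tL; split=> // tx; move: t0; rewrite (pointed t.1.1) ?eqxx //.
    by apply: (addIr (dz t.2)); rewrite add0r [RHS](hdz _ Et).2.
  by rewrite big_map big_filter.
apply: (minE x Ex) => y; have [r [hr ->]] := spanE y.
apply: lin_span_sum => e /hr Ee; have [->|ne] := pselect (e.2 = x); first by [].
exact: lin_span_mem.
Qed.

End MinimalGenerators.

Theorem theorem1p3 (k : fieldType) (d n : nat) (b : 'M[int]_(d, n))
    (Delta : {set {set 'I_n}}) (l : nat) (c : 'I_l -> class_group b)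
    (M : gr_module k b) :
  smooth_projective_fan b Delta ->
  minimal_semigroup_generators c (nef Delta) ->
  finitely_generated M ->
  (exists m : class_group b, regular Delta c M m) ->
  forall E : M -> Prop, minimal_homog_generators E ->
  forall (x : M) (p : class_group b), E x -> piece p x ->
  ~ reg_shift Delta c M p.
Proof.
move=> [smooth complete [A convA]] minc _ _ E minE x p Ex px [r [j [q [[reg1 reg0] NCq ep]]]].
have [[D nefD cE] c0] := minimal_semigroup_generator j minc.
(* The Koszul complex is that of one monomial [mu h] of degree [c j] for each
   maximal cone [sigma h]. *)
pose mc := [set sigma in Delta | #|sigma| == d].
pose sigma (h : 'I_#|mc|) : {set 'I_n} := enum_val h.
have sigmaP h : sigma h \in Delta /\ #|sigma h| = d.
  by have := enum_valP h; rewrite inE => /andP[? /eqP].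
have cofinal tau : tau \in Delta -> exists h, tau \subset sigma h.
  move=> /(maximal_cone smooth complete)[rho [hr tr cr]].
  have mr : rho \in mc by rewrite inE hr cr eqxx.
  by exists (enum_rank_in mr rho); rewrite /sigma enum_rankK_in.
have /choice[mu hmu] : forall h, exists m : 'X_{1..n}, mon_degree b m = c j /\
    {in sigma h, forall i, m i = 0%N}.
  move=> h; have [hs cs] := sigmaP h; rewrite -cE.
  have [m [hm1 hm2]] := nef_effective_off_cone smooth complete convA nefD hs cs.
  by exists m; split=> // i si; exact: hm2.
pose gam h := off_cone (sigma h); pose k1 := (\sum_h \sum_i mu h i)%N.
have gam_le1 h i : (gam h i <= 1)%N by rewrite mnmE leq_b1.
have mu_le h : (mu h <= gam h *+ k1)%MM.
  apply/mnm_lepP => i; rewrite mulmnE mnmE.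
  have [si|si] := boolP (i \in sigma h); first by rewrite (hmu h).2.
  by rewrite mul1n /k1 (bigD1 h) //= (bigD1 i) //= -addnA leq_addr.
have torsionE (N : lmodType {mpoly k[n]}) (y : N) : torsion Delta y <-> mon_torsion gam y.
  by apply: torsion_mon_torsion => // h; have [] := sigmaP h.
(* The regularity of [r], with all the weight [i - 1] of [lam] at [j]. *)
have local_van i : local_cohomology_eq0 Delta M i (p - c j *+ i).
  case: i => [|i]; first by rewrite mulr0n subr0 ep addrA; exact: reg0.
  have -> : p - c j *+ i.+1 = r - \sum_j' c j' *+ (if j' == j then i else 0%N) + q.
    rewrite (bigD1 j) //= eqxx big1 ?addr0 => [|j' /negPf ->]; last by rewrite mulr0n.
    by rewrite ep mulrS addrCA opprD addrACA subrr add0r addrAC.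
  apply: reg1 => //.
  rewrite (bigD1 j) //= eqxx big1 ?addn0 ?subn1 // => j' /negPf ->; exact: erefl.
have [I _] := local_van 0%N.
have vanishing i : torsion_cohomology_eq0 Delta I i (p - c j *+ i).
  (* The vanishing may be witnessed by a different resolution for every [i]. *)
  have [J] := local_van i.
  by apply: (torsion_cohomology_independent (sigma := sigma)) => // h; have [] := sigmaP h.
have mu_deg h : mon_degree b (mu h) = c j by have [] := hmu h.
have [m xE] := generated_by_monomials mu_deg gam_le1 mu_le torsionE vanishing px.
apply: (minimal_generator_not_nonconstant_comb _ minE Ex px).
  exact: mon_degree_eq0 complete.
rewrite xE; apply: nonconstant_comb_sum => h _; apply: nonconstant_combZ.
  by apply: contra c0 => /eqP e; rewrite -(mu_deg h) e mon_degree0.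
by have [_ spanE _] := minE.
Qed.
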